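(* Let $G$ be a compact group and let $S\subset C(G)$ be a finite-dimensional biregular-invariant subspace. Then there is a finite set $\Lambda\subset\widehat G$ such that $S=\bigoplus_{\pi\in\Lambda}\mathcal E_\pi(G)$, and $$\boldsymbol\lambda(S)=\int_G\Big|\sum_{\pi\in\Lambda}d_\pi\,\chi_\pi(g)\Big|\,d\mu_G(g),$$ where $\mu_G$ is the normalized Haar measure on $G$.
   Context: All function spaces and representations are complex; inner products are linear in the first variable. $C(G)$ carries the supremum norm. The biregular action of $G\times G$ on $G$ is $(a,b)\bullet x=axb^{-1}$, inducing $((a,b)\bullet f)(x)=f(a^{-1}xb)$ on $C(G)$. A subspace $S\subset C(G)$ is biregular-invariant if $(a,b)\bullet f\in S$ for all $f\in S$ and $a,b\in G$. $\widehat G$ is the set of equivalence classes of irreducible unitary representations $\pi\colon G\to\mathcal U(V_\pi)$ (one representative per class), $d_\pi=\dim V_\pi$, $\chi_\pi(g)=\operatorname{tr}\pi(g)$, and $\mathcal E_\pi(G)=\operatorname{span}\{x\mapsto\langle v,\pi(x)u\rangle:u,v\in V_\pi\}\subset C(G)$. Projection constants: $\boldsymbol\lambda(X,Y)=\inf\{\|P\|: P\in\mathcal L(Y),\ P^2=P,\ P(Y)=X\}$, $\boldsymbol\lambda(X)=\sup_Y\boldsymbol\lambda(X,Y)$ over all Banach spaces $Y$ containing $X$ isometrically; $S$ carries the supremum norm. *)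

(* Defs.v *)
From HB Require Import structures.
From mathcomp Require Import all_boot all_order all_algebra.
From mathcomp Require Import spectral.
From mathcomp Require Import complex.
From mathcomp Require Import finmap.
From mathcomp Require Import all_classical all_reals all_analysis.

Set Implicit Arguments.
Unset Strict Implicit.
Unset Printing Implicit Defensive.

Import Order.TTheory GRing.Theory Num.Theory.
Import numFieldNormedType.Exports.

Local Open Scope classical_set_scope.
Local Open Scope ring_scope.

(* [R[i]] itself is canonically an [lmodType R]; going through a
   [numClosedFieldType] gives the complex numbers the topology, the norm and
   the module structure over themselves. *)
Definition Cplx (R : realType) : numClosedFieldType := R[i].

(* Norms of complex normed modules take their values in the scalar field. *)
Definition rnorm (R : realType) (V : normedZmodType (Cplx R)) (x : V) : R :=
  complex.Re (`|x| : R[i]).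

Section rnorm_theory.
Context {R : realType} {V : normedZmodType (Cplx R)}.
Implicit Types x y : V.

Lemma rnormE x : `|x| = (rnorm x)%:C%C :> R[i].
Proof.
have : (0 : R[i]) <= (`|x| : R[i]) by exact: (normr_ge0 x).
rewrite /rnorm lecE /= => /andP[+ _].
by case: (`|x| : R[i]) => a b /= /eqP ->.
Qed.

Lemma rnorm_ge0 x : 0 <= rnorm x.
Proof.
have : (0 : R[i]) <= (`|x| : R[i]) by exact: (normr_ge0 x).
by rewrite lecE /= => /andP[].
Qed.

Lemma ler_rnormD x y : rnorm (x + y) <= rnorm x + rnorm y.
Proof.
have : (`|x + y| : R[i]) <= (`|x| : R[i]) + (`|y| : R[i]) by exact: (ler_normD x y).
by rewrite !rnormE -rmorphD /= lecR.
Qed.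

Lemma rnorm_eq0 x : rnorm x = 0 -> x = 0.
Proof.
move=> x0; apply/eqP; rewrite -normr_eq0; apply/eqP.
by have := rnormE x; rewrite x0.
Qed.

End rnorm_theory.

Lemma rnormM (R : realType) (a b : Cplx R) :
  rnorm (a * b) = rnorm a * rnorm b.
Proof.
apply: (@complexI R); rewrite rmorphM /= -!rnormE.
exact: (normrM a b).
Qed.

Lemma rnorm_continuous (R : realType) : continuous (fun z : Cplx R => rnorm z : R).
Proof.
move=> z; apply/(@cvgrPdist_lt _ _ _ _ (nbhs_filter z)) => e e0.
have e0' : (0 : Cplx R) < (e%:C%C : R[i]) by rewrite ltcR.
apply/nbhs_ballP; exists (e%:C%C : R[i]) => // t; rewrite /ball/= => zt.
have {}zt : rnorm (z - t) < e by rewrite -(@ltcR R) -rnormE.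
apply: le_lt_trans zt.
have h1 := ler_rnormD (z - t) t; rewrite subrK in h1.
have h2 := ler_rnormD (t - z) z; rewrite subrK in h2.
have h3 : rnorm (t - z) = rnorm (z - t) by rewrite /rnorm distrC.
by rewrite ler_norml -lerN2 opprK opprB !lerBlDr h1 -{1}h3 h2.
Qed.

HB.mixin Record isCompactHausdorff T & Topological T := {
  compact_setT : compact [set: T];
  hausdorff_setT : hausdorff_space T
}.

#[short(type="compactHausdorffType")]
HB.structure Definition CompactHausdorff :=
  {T of Topological T & isCompactHausdorff T}.

HB.mixin Record isTopologicalGroup G & Topological G & Group G := {
  mulg_continuous : continuous (fun p : G * G => (p.1 * p.2)%g);
  invg_continuous : continuous (fun x : G => (x^-1)%g)
}.

(* The base point is only there because the measurable types of the library
   are pointed. *)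
#[short(type="compactGroupType")]
HB.structure Definition CompactGroup :=
  {G of PointedTopological G & CompactHausdorff G & Group G
      & isTopologicalGroup G}.

Section continuous_functions.
Context {R : realType} {K : compactHausdorffType}.

Definition cfun : Type := continuousType K (Cplx R).
Definition cfun_fun (f : cfun) : K -> Cplx R := f.
Coercion cfun_fun : cfun >-> Funclass.

Implicit Types (f g : cfun) (a : Cplx R).

HB.instance Definition _ := Choice.on cfun.

Lemma cfunP f g : f =1 g -> f = g.
Proof. by move=> fg; apply/continuousEP. Qed.

Lemma cfun_continuous f : continuous f.
Proof. exact: cts_fun. Qed.

Definition mkcfun (f : K -> Cplx R) (cf : continuous f) : cfun :=
  (mkcts cf : continuousType K (Cplx R)).

Fact cfun0_subproof : continuous (fun _ : K => 0 : Cplx R).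
Proof. by move=> x; exact: cvg_cst. Qed.
Definition cfun0 := mkcfun cfun0_subproof.

Fact cfunN_subproof f : continuous (fun x => - f x).
Proof. by move=> x; exact: (cvgN (@cfun_continuous f x)). Qed.
Definition cfunN f := mkcfun (@cfunN_subproof f).

Fact cfunD_subproof f g : continuous (fun x => f x + g x).
Proof.
by move=> x; exact: (cvgD (@cfun_continuous f x) (@cfun_continuous g x)).
Qed.
Definition cfunD f g := mkcfun (@cfunD_subproof f g).

Fact cfunZ_subproof a f : continuous (fun x => a * f x).
Proof.
move=> x; exact: (cvgM (cvg_cst a) (@cfun_continuous f x)).
Qed.
Definition cfunZ a f := mkcfun (@cfunZ_subproof a f).

Fact cfunDA : associative cfunD.
Proof. by move=> f g h; apply: cfunP => x /=; exact: addrA. Qed.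
Fact cfunDC : commutative cfunD.
Proof. by move=> f g; apply: cfunP => x /=; exact: addrC. Qed.
Fact cfun0D : left_id cfun0 cfunD.
Proof. by move=> f; apply: cfunP => x /=; exact: add0r. Qed.
Fact cfunND : left_inverse cfun0 cfunN cfunD.
Proof. by move=> f; apply: cfunP => x /=; exact: addNr. Qed.

HB.instance Definition _ :=
  GRing.isZmodule.Build cfun cfunDA cfunDC cfun0D cfunND.

Fact cfunZA a b f : cfunZ a (cfunZ b f) = cfunZ (a * b) f.
Proof. by apply: cfunP => x /=; exact: mulrA. Qed.
Fact cfun1Z : left_id 1 cfunZ.
Proof. by move=> f; apply: cfunP => x /=; exact: mul1r. Qed.
Fact cfunZDr : right_distributive cfunZ +%R.
Proof. by move=> a f g; apply: cfunP => x /=; exact: mulrDr. Qed.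
Fact cfunZDl f : {morph cfunZ^~ f : a b / a + b}.
Proof. by move=> a b; apply: cfunP => x /=; exact: mulrDl. Qed.

HB.instance Definition _ :=
  GRing.Zmodule_isLmodule.Build (Cplx R) cfun cfunZA cfun1Z cfunZDr cfunZDl.

Definition cfun_vals f : set R := [set rnorm (f x) | x in [set: K]].

Definition sup_norm f : Cplx R := ((sup (cfun_vals f))%:C)%C.

Lemma cfun_vals_ubound f : has_ubound (cfun_vals f).
Proof.
have cf : continuous (fun x => rnorm (f x)).
  move=> x; apply: (@continuous_comp _ _ _ f (fun z : Cplx R => rnorm z : R)).
    exact: cfun_continuous.
  exact: rnorm_continuous.
have /compact_bounded/pinfty_ex_gt0[M _ hM] :
    compact ((fun x => rnorm (f x)) @` [set: K]).
  apply: continuous_compact; last exact: compact_setT.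
  exact: continuous_subspaceT.
exists M => _ [x _ <-].
by apply: le_trans (hM _ _); [exact: ler_norm|exists x].
Qed.

Lemma cfun_vals_le f x : rnorm (f x) <= sup (cfun_vals f).
Proof. by apply: ub_le_sup; [exact: cfun_vals_ubound|exists x]. Qed.

Lemma sup_cfun_vals_ge0 f : 0 <= sup (cfun_vals f).
Proof.
have [[_ [x _ _]]|/nonemptyPn ->] := pselect (cfun_vals f !=set0).
  exact: le_trans (rnorm_ge0 _) (cfun_vals_le f x).
by rewrite sup0.
Qed.

Lemma sup_cfun_vals_le f (c : R) :
  0 <= c -> (forall x, rnorm (f x) <= c) -> sup (cfun_vals f) <= c.
Proof.
move=> c0 fc; have [ne|/nonemptyPn ->] := pselect (cfun_vals f !=set0).
  by apply: ge_sup => // _ [x _ <-].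
by rewrite sup0.
Qed.

Fact sup_normD f g : sup_norm (f + g) <= sup_norm f + sup_norm g.
Proof.
rewrite -[is_true _]/(is_true (((sup (cfun_vals (f + g)))%:C%C : R[i]) <=
  (sup (cfun_vals f))%:C%C + (sup (cfun_vals g))%:C%C)) -rmorphD /= lecR.
apply: sup_cfun_vals_le => [|x]; first by rewrite addr_ge0// sup_cfun_vals_ge0.
by apply: le_trans (ler_rnormD _ _) _; rewrite lerD// cfun_vals_le.
Qed.

Fact sup_normZ a f : sup_norm (a *: f) = `|a| * sup_norm f.
Proof.
have E x : rnorm ((a *: f) x) = rnorm a * rnorm (f x) by exact: rnormM.
rewrite -[RHS]/((`|a| : R[i]) * ((sup (cfun_vals f))%:C)%C) rnormE -rmorphM /=.
congr (_%:C)%C.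
apply/eqP; rewrite eq_le; apply/andP; split.
  apply: sup_cfun_vals_le => [|x].
    by rewrite mulr_ge0 ?rnorm_ge0 ?sup_cfun_vals_ge0.
  by rewrite E ler_wpM2l ?rnorm_ge0 ?cfun_vals_le.
have [->|a0] := eqVneq (rnorm a) 0; first by rewrite mul0r sup_cfun_vals_ge0.
have {}a0 : 0 < rnorm a by rewrite lt_def a0 rnorm_ge0.
rewrite -ler_pdivlMl//; apply: sup_cfun_vals_le => [|x].
  by rewrite mulr_ge0 ?invr_ge0 ?rnorm_ge0 ?sup_cfun_vals_ge0.
by rewrite ler_pdivlMl// -E cfun_vals_le.
Qed.

Fact sup_norm_eq0 f : sup_norm f = 0 -> f = 0.
Proof.
move=> /(@complexI R) f0; apply: cfunP => x; apply: rnorm_eq0.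
by apply/eqP; rewrite eq_le rnorm_ge0 -f0 cfun_vals_le.
Qed.

HB.instance Definition _ :=
  Lmodule_isNormed.Build (Cplx R) cfun sup_normD sup_normZ sup_norm_eq0.

End continuous_functions.
Arguments cfun : clear implicits.

Section subspaces.
Context {K : numFieldType} {V : normedModType K} (S : submodClosed V).

Record subsp : predArgType :=
  Subsp { subsp_val :> V; _ : subsp_val \in S }.

HB.instance Definition _ := [isSub for subsp_val].
HB.instance Definition _ := [Choice of subsp by <:].
HB.instance Definition _ := [SubChoice_isSubLmodule of subsp by <:].

Definition subsp_norm (x : subsp) : K := `|subsp_val x|.

Fact subsp_normD x y : subsp_norm (x + y) <= subsp_norm x + subsp_norm y.
Proof. exact: ler_normD. Qed.
Fact subsp_normZ a x : subsp_norm (a *: x) = `|a| * subsp_norm x.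
Proof. exact: normrZ. Qed.
Fact subsp_norm_eq0 x : subsp_norm x = 0 -> x = 0.
Proof. by move=> /normr0_eq0 x0; exact: val_inj. Qed.

HB.instance Definition _ :=
  Lmodule_isNormed.Build K subsp subsp_normD subsp_normZ subsp_norm_eq0.

End subspaces.

Section linear_spans.
Context {K : nzRingType} {V : lmodType K}.

Definition lspan (A : set V) : set V :=
  [set x | exists n (c : 'I_n -> K) (a : 'I_n -> V),
     (forall i, A (a i)) /\ x = \sum_i c i *: a i].

Definition finite_dimensional (S : set V) :=
  exists s : seq V, S = lspan [set` s].

Definition is_direct_sum (I : choiceType) (L : {fset I}) (E : I -> set V)
    (S : set V) :=
  S = [set \sum_(i <- L) F i | F in [set F : I -> V |
                                      forall i, i \in L -> E i (F i)]] /\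
  forall F : I -> V, (forall i, i \in L -> E i (F i)) ->
    \sum_(i <- L) F i = 0 -> forall i, i \in L -> F i = 0.

End linear_spans.

Section projection_constants.
Context {R : realType}.
Local Open Scope ereal_scope.

Definition opnorm (Y : normedModType (Cplx R)) (P : Y -> Y) : \bar R :=
  ereal_sup [set (rnorm (P y))%:E | y in [set y : Y | (rnorm y <= 1)%R]].

Definition rel_projconst (Y : normedModType (Cplx R)) (X : set Y) : \bar R :=
  ereal_inf [set opnorm P | P in [set P : {linear Y -> Y} |
    [/\ continuous P, P \o P = P :> (Y -> Y) & range P = X]]].

Definition projconst (X : normedModType (Cplx R)) : \bar R :=
  ereal_sup [set l | exists (Y : completeNormedModType (Cplx R))
                            (j : {linear X -> Y}),
    (forall x, `|j x| = `|x|)%R /\ l = rel_projconst (range j)].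

End projection_constants.

Section haar.
Context {R : realType} {G : compactGroupType}.

Definition borelType := g_sigma_algebraType (@open G).

Definition is_haar (mu : {measure set borelType -> \bar R}) :=
  [/\ forall (a : G) (A : set borelType), measurable A ->
        mu [set (a * x)%g | x in (A : set G)] = mu A,
      forall A : set borelType, measurable A ->
        mu A = ereal_inf [set mu U | U in [set U : set G |
                                            open U /\ A `<=` U]]
    & forall U : set G, open U ->
        mu U = ereal_sup [set mu C | C in [set C : set G |
                                            compact C /\ C `<=` U]]].

End haar.
Arguments borelType : clear implicits.

Section biregular.
Context {R : realType} {G : compactGroupType}.

Fact biregular_subproof (a b : G) (f : cfun R G) :
  continuous (fun x : G => f (a^-1 * x * b)%g).
Proof.
move=> x; apply: (@continuous_comp _ _ _ (fun x : G => a^-1 * x * b)%g f);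
  last exact: cfun_continuous.
apply: (@continuous_comp _ _ _ (fun x : G => (a^-1 * x, b)%g)
  (fun p : G * G => p.1 * p.2)%g); last exact: mulg_continuous.
apply: cvg_pair; last exact: cvg_cst.
apply: (@continuous_comp _ _ _ (fun x : G => (a^-1, x)%g)
  (fun p : G * G => p.1 * p.2)%g); last exact: mulg_continuous.
by apply: cvg_pair; [exact: cvg_cst|exact: cvg_id].
Qed.
Definition biregular (a b : G) (f : cfun R G) : cfun R G :=
  mkcfun (@biregular_subproof a b f).

Definition biregular_invariant (S : set (cfun R G)) :=
  forall (a b : G) f, S f -> S (biregular a b f).

End biregular.

Section representations.
Context (R : realType) (G : compactGroupType).
Local Notation C := (Cplx R).
Local Open Scope sesquilinear_scope.
Local Open Scope quotient_scope.

(* The representation space is the Hilbert space of column vectors of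
   dimension [rdim]. *)
Record unitary_rep := UnitaryRep {
  rdim : nat;
  rmx :> G -> 'M[C]_rdim;
  rmxM : forall x y, rmx (x * y)%g = rmx x *m rmx y;
  rmx_unitary : forall x, rmx x \is unitarymx;
  rmx_continuous : forall u : 'cV[C]_rdim, continuous (fun x => rmx x *m u)
}.

Definition irreducible_rep (pi : unitary_rep) :=
  (0 < rdim pi)%N /\
  forall W : {vspace 'cV[C]_(rdim pi)},
    (forall x u, u \in W -> pi x *m u \in W) -> W = 0%VS \/ W = fullv.

Record irrep := Irrep {
  irrep_rep :> unitary_rep;
  irrepP : irreducible_rep irrep_rep
}.

HB.instance Definition _ := gen_eqMixin irrep.
HB.instance Definition _ := gen_choiceMixin irrep.

Definition rep_equiv (p q : irrep) : bool :=
  `[< exists T : 'M[C]_(rdim q, rdim p),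
        [/\ T \is unitarymx, T^t* \is unitarymx
          & forall x, T *m p x = q x *m T] >].

Fact rep_equiv_refl : reflexive rep_equiv.
Proof.
move=> p; apply/asboolP; exists 1%:M.
rewrite trmxC_unitary; split=> [||x]; last by rewrite mul1mx mulmx1.
  by apply/unitarymxP; rewrite trmx1 map_mx1 mul1mx.
by apply/unitarymxP; rewrite trmx1 map_mx1 mul1mx.
Qed.
Fact rep_equiv_sym : symmetric rep_equiv.
Proof.
suff sym p q : rep_equiv p q -> rep_equiv q p.
  by move=> p q; apply/idP/idP; exact: sym.
move=> /asboolP[T [T1 T2 Tpq]]; apply/asboolP; exists (T^t*).
split; rewrite ?trmxCK// => x.
have /unitarymxP TT := T1; have /unitarymxP := T2; rewrite trmxCK => TT'.
rewrite -[LHS]mulmx1 -TT mulmxA -(mulmxA _ (q x)) -Tpq.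
by rewrite (mulmxA _ T) TT' mul1mx.
Qed.
Fact rep_equiv_trans : transitive rep_equiv.
Proof.
move=> q p r /asboolP[T [T1 T2 Tpq]] /asboolP[U [U1 U2 Uqr]].
apply/asboolP; exists (U *m T); rewrite trmx_mul map_mxM.
split=> [||x]; [exact: mul_unitarymx|exact: mul_unitarymx|].
by rewrite -mulmxA Tpq mulmxA Uqr mulmxA.
Qed.

Canonical rep_equiv_equiv :=
  EquivRel rep_equiv rep_equiv_refl rep_equiv_sym rep_equiv_trans.

Definition dual := {eq_quot rep_equiv}.
HB.instance Definition _ := Choice.on dual.

Definition character (pi : unitary_rep) (g : G) : C := \tr (pi g).

(* [dotmx] is the inner product of row vectors, linear in the first variable. *)
Fact matrix_coef_subproof (pi : unitary_rep) (v u : 'cV[C]_(rdim pi)) :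
  continuous (fun x : G => dotmx v^T (pi x *m u)^T).
Proof.
have -> : (fun x : G => dotmx v^T (pi x *m u)^T) =
    (fun x => \sum_i v i 0 * ((pi x *m u) i 0)^* ).
  apply/funext => x; rewrite dotmxE mxE; apply: eq_bigr => i _.
  by rewrite !mxE.
have cconj : continuous (fun z : C => z^* ).
  move=> z; apply/(@cvgrPdist_lt _ _ _ _ (nbhs_filter z)) => e e0.
  apply/nbhs_ballP; exists e => // t; rewrite /ball/= => zt.
  by rewrite -rmorphB norm_conjC.
move=> x; apply: cvg_big => [|i _]; first exact: add_continuous.
 apply: cvgM; first exact: cvg_cst.
apply: (@continuous_comp _ _ _ (fun x => (pi x *m u) i 0) (fun z : C => z^* ));
  last exact: cconj.
apply: (@continuous_comp _ _ _ (fun x => pi x *m u)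
  (fun M : 'cV[C]_(rdim pi) => M i 0)); first exact: rmx_continuous.
exact: coord_continuous.
Qed.
Definition matrix_coef (pi : unitary_rep) (v u : 'cV[C]_(rdim pi)) : cfun R G :=
  mkcfun (@matrix_coef_subproof pi v u).

Definition coef_space (pi : unitary_rep) : set (cfun R G) :=
  lspan [set f | exists v u : 'cV[C]_(rdim pi), f = matrix_coef v u].

End representations.

(* Main.v *)
(** The projection constant is squeezed between two estimates that use only the
    kernel [k = \sum_(p in L) d_p conj chi_p], which reproduces S:
    [f x = \int k(y^-1 x) f y dmu(y)] for f in S.

    Upper bound.  Replace the integral by a Riemann sum with nodes [y_j] and
    weights [w_j].  If Y contains S isometrically, extend the evaluations at the
    [y_j] to norm-one functionals [psi_j] on Y (Hahn-Banach);
    [v |-> \sum_j w_j psi_j v k(y_j^-1 .)] maps Y to S with norm close to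
    [\int |k|] and is close to the identity on S.  Extending also the (finitely
    many) coordinate functionals of S gives a small correction that makes it an
    exact projection.

    Lower bound.  For a projection P of C(G) onto S and [|h| <= 1], the number
    [\int (P h(y^-1 .))(y) dmu(y)] is at most [|P|]; by trace duality it is the
    trace on S of the convolution by h, that is [\int k(y) h(y^-1) dmu(y)], which
    for [h = k / (|k| + eps)] is at least [\int |k| - eps].

    The decomposition of S comes from Schur orthogonality: S embeds in a finite
    sum of coefficient spaces as the coefficients of its own left-regular
    representation, and an element orthogonal to all the translates of f has no
    component along any p on which f has a nonzero component. *)

From HB Require Import structures.
Require Import Defs.
From mathcomp Require Import all_boot all_order all_algebra.
From mathcomp Require Import spectral complex finmap.
From mathcomp Require Import all_classical all_reals all_analysis.
From mathcomp Require Import measurable_realfun lra ring.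

Set Implicit Arguments.
Unset Strict Implicit.
Unset Printing Implicit Defensive.

Import Order.TTheory GRing.Theory Num.Theory.
Import numFieldNormedType.Exports.

Local Open Scope classical_set_scope.
Local Open Scope ring_scope.

(** The upper bound lives in an arbitrary Y, so the reproducing integral is discretised and only
    finitely many functionals have to be extended. One rule must serve several integrands at once,
    uniformly in x: [e_i y * k(y^-1 x)] makes the sum reproduce S up to d, and [|k(y^-1 x)|]
    controls the norm. The bounds [B_i] of the extended coordinates are fixed before the rule is
    chosen, so the correction costs at most [d * \sum_i B_i], which tends to 0 with d. In the lower
    bound the limit value does not depend on P: expanding [P h(y^-1 .)] in an orthonormal basis of S
    moves P onto the convolutions of the [e_i] with h. These lie in S because S is stable under
    right translations, and P fixes S. Trace duality thus takes the place of averaging P over the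
    group. The conjugate in k comes from the coefficients [<v, pi(x) u>], which are antilinear in
    [pi(x)]; it does not change [|k|]. *)

Section complex_scalars.
Context {R : realType}.
Local Notation C := (Cplx R).
Implicit Types (z w : C) (r : R).

Definition cre z : R := complex.Re z.
Definition cim z : R := complex.Im z.
Definition rC r : C := (r%:C)%C.

Lemma cplxP z w : cre z = cre w -> cim z = cim w -> z = w.
Proof. by case: z => a b; case: w => c d /= -> ->. Qed.

Lemma creD z w : cre (z + w) = cre z + cre w. Proof. by case: z; case: w. Qed.
Lemma cimD z w : cim (z + w) = cim z + cim w. Proof. by case: z; case: w. Qed.
Lemma creN z : cre (- z) = - cre z. Proof. by case: z. Qed.
Lemma cimN z : cim (- z) = - cim z. Proof. by case: z. Qed.
Lemma creM z w : cre (z * w) = cre z * cre w - cim z * cim w.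
Proof. by case: z; case: w. Qed.
Lemma cimM z w : cim (z * w) = cre z * cim w + cim z * cre w.
Proof. by case: z; case: w => a b c d /=; rewrite /cim /=. Qed.
Lemma cre_conj z : cre z^* = cre z. Proof. by case: z. Qed.
Lemma cim_conj z : cim z^* = - cim z. Proof. by case: z. Qed.
Lemma cre_rC r : cre (rC r) = r. Proof. by []. Qed.
Lemma cim_rC r : cim (rC r) = 0. Proof. by []. Qed.
Lemma cre0 : cre 0 = 0. Proof. by []. Qed.
Lemma cim0 : cim 0 = 0. Proof. by []. Qed.

Lemma normC_rnorm z : `|z| = rC (rnorm z).
Proof. exact: rnormE. Qed.

Lemma rC_lt r s : (rC r < rC s) = (r < s).
Proof. exact: ltcR. Qed.
Lemma rCM r s : rC (r * s) = rC r * rC s.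
Proof. exact: (rmorphM (real_complex R)). Qed.
Lemma rCD r s : rC (r + s) = rC r + rC s.
Proof. exact: (rmorphD (real_complex R)). Qed.
Lemma rCN r : rC (- r) = - rC r.
Proof. exact: (rmorphN (real_complex R)). Qed.
Lemma rC_sum I (s : seq I) (P : pred I) (F : I -> R) :
  rC (\sum_(i <- s | P i) F i) = \sum_(i <- s | P i) rC (F i).
Proof. exact: (rmorph_sum (real_complex R)). Qed.
Lemma rC_inj : injective rC.
Proof. exact: complexI. Qed.
Lemma rC1 : rC 1 = 1. Proof. by []. Qed.
Lemma rC0 : rC 0 = 0. Proof. by []. Qed.
Lemma gt0_rC z : 0 < z -> exists2 r, 0 < r & z = rC r.
Proof.
rewrite ltcE /= => /andP[/eqP z0 r0]; exists (cre z) => //.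
exact: cplxP.
Qed.
Lemma rC_conj r : (rC r)^* = rC r.
Proof. by apply: cplxP; rewrite ?cre_conj ?cim_conj ?cim_rC ?oppr0. Qed.

Lemma rnorm_sqr z : rnorm z ^+ 2 = cre z ^+ 2 + cim z ^+ 2.
Proof.
apply: rC_inj; rewrite expr2 rCM -normC_rnorm -expr2.
exact/esym/(add_Re2_Im2 (z : R[i])).
Qed.

Lemma normCKr z : z * z^* = rC (rnorm z ^+ 2).
Proof. by rewrite -normCK normC_rnorm !expr2 rCM. Qed.

Lemma rnorm_rC r : rnorm (rC r) = `|r|.
Proof.
rewrite -sqrtr_sqr /rnorm (normc_def (rC r : R[i])) /=.
by rewrite expr0n addr0.
Qed.

Lemma cre_le_rnorm z : `|cre z| <= rnorm z.
Proof.
rewrite -ler_sqr ?nnegrE ?rnorm_ge0 ?normr_ge0// real_normK ?num_real//.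
by rewrite rnorm_sqr lerDl sqr_ge0.
Qed.

Lemma cim_le_rnorm z : `|cim z| <= rnorm z.
Proof.
rewrite -ler_sqr ?nnegrE ?rnorm_ge0 ?normr_ge0// real_normK ?num_real//.
by rewrite rnorm_sqr lerDr sqr_ge0.
Qed.

Lemma rnorm_le_reim z : rnorm z <= `|cre z| + `|cim z|.
Proof.
rewrite -ler_sqr ?nnegrE ?rnorm_ge0 ?addr_ge0//.
rewrite rnorm_sqr -(real_normK (num_real (cre z))) -(real_normK (num_real (cim z))).
by rewrite sqrrD lerD2r lerDl mulrn_wge0// mulr_ge0.
Qed.

Lemma rnorm_conj z : rnorm z^* = rnorm z.
Proof. by rewrite /rnorm norm_conjC. Qed.

End complex_scalars.

Section rnorm_extra.
Context {R : realType} {V : normedZmodType (Cplx R)}.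
Implicit Types x y : V.

Lemma norm_rnorm x : `|x| = rC (rnorm x).
Proof. exact: rnormE. Qed.

Lemma rnorm0 : rnorm (0 : V) = 0.
Proof. by rewrite /rnorm normr0. Qed.

Lemma rnormN x : rnorm (- x) = rnorm x.
Proof. by rewrite /rnorm normrN. Qed.

Lemma rnormB x y : rnorm (x - y) = rnorm (y - x).
Proof. by rewrite -opprB rnormN. Qed.

Lemma rnorm_sum I (s : seq I) (P : pred I) (F : I -> V) :
  rnorm (\sum_(i <- s | P i) F i) <= \sum_(i <- s | P i) rnorm (F i).
Proof.
elim/big_rec2: _ => [|i b a _ ab]; first by rewrite rnorm0.
by apply: le_trans (ler_rnormD _ _) _; rewrite lerD2l.
Qed.

End rnorm_extra.

Lemma rnormZ (R : realType) (V : normedModType (Cplx R)) (a : Cplx R) (x : V) :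
  rnorm (a *: x) = rnorm a * rnorm x.
Proof.
apply: rC_inj; rewrite rCM; have := normrZ a x.
by rewrite !rnormE.
Qed.

(** * The complex Hahn-Banach theorem *)

Section hahn_banach.
Context {R : realType} {Y : normedModType (Cplx R)}.
Implicit Types (A : set (Y * R)) (M : R).

(* A real-linear partial functional bounded by [M * rnorm], as a set of pairs;
   domination makes the set single-valued, see [real_dominated_graph_fun]. *)
Definition real_dominated_graph M A :=
  [/\ A (0, 0),
      forall u v, A u -> A v -> A (u.1 + v.1, u.2 + v.2),
      forall (t : R) u, A u -> A (rC t *: u.1, t * u.2)
    & forall u, A u -> u.2 <= M * rnorm u.1].

Lemma real_dominated_graph_fun M A y r s : real_dominated_graph M A ->
  A (y, r) -> A (y, s) -> r = s.
Proof.
move=> [A0 AD AZ Ale].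
suff le a b : A (y, a) -> A (y, b) -> a <= b.
  by move=> rA sA; apply/eqP; rewrite eq_le !le.
(* The pair [(0, a - b)] lies in the graph, and domination at 0 reads [a - b <= 0]. *)
move=> aA bA; have := AD _ _ aA (AZ (-1) _ bA).
move=> /Ale /=; rewrite mulN1r.
by rewrite rCN rC1 scaleN1r subrr rnorm0 mulr0 subr_le0.
Qed.

(** Chains are bounded above, as Zorn's lemma requires: each condition involves at most two elements
    of the union, and these lie in a common member of the chain. *)
Lemma real_dominated_graph_bigcup M (G0 : set (Y * R)) (F : set (set (Y * R))) :
  real_dominated_graph M G0 -> total_on F subset ->
  (forall A, F A -> real_dominated_graph M (A `|` G0)) ->
  real_dominated_graph M ((\bigcup_(A in F) A) `|` G0).
Proof.
move=> G0P Ftot FP.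
have bigF u : ((\bigcup_(A in F) A) `|` G0) u ->
    exists B, [/\ real_dominated_graph M B, B u, G0 `<=` B,
      B `<=` (\bigcup_(A in F) A) `|` G0 & B = G0 \/ exists2 A, F A & B = A `|` G0].
  case=> [[A FA Au]|G0u].
    exists (A `|` G0); split; [exact: FP|by left|by right| |by right; exists A].
    by move=> v [Av|]; [left; exists A|right].
  by exists G0; split; [by []|by []|by []|by move=> v; right|by left].
have big2 u v : ((\bigcup_(A in F) A) `|` G0) u ->
    ((\bigcup_(A in F) A) `|` G0) v ->
    exists B, [/\ real_dominated_graph M B, B u, B v &
      B `<=` (\bigcup_(A in F) A) `|` G0].
  move=> /bigF[A [AP Au G0A AF Ac]] /bigF[B [BP Bv G0B BF Bc]].
  have [AB|BA] : A `<=` B \/ B `<=` A.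
    case: Ac => [->|[A' FA' AE]]; first by left.
    case: Bc => [->|[B' FB' BE]]; first by right.
    rewrite AE BE; case: (Ftot _ _ FA' FB') => sub; [left|right].
      by move=> w [/sub|]; [left|right].
    by move=> w [/sub|]; [left|right].
  - by exists B; split => //; exact: AB.
  - by exists A; split => //; exact: BA.
split.
- by right; case: G0P.
- move=> u v /big2 /[apply] -[B [[_ BD _ _] Bu Bv]]; apply; exact: BD.
- by move=> t u /bigF[B [[_ _ BZ _] Bu _ + _]]; apply; exact: BZ.
- by move=> u /bigF[B [[_ _ _ Bl] Bu _ _ _]]; exact: Bl.
Qed.

(** The one-dimensional extension step. By subadditivity of the norm every lower constraint on the
    value at [y0] (from the coefficient -1) is below every upper constraint (from the coefficient
    1), so an admissible value exists. *)
Lemma real_dominated_graph_extend M A (y0 : Y) : 0 <= M ->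
  real_dominated_graph M A -> exists2 B, real_dominated_graph M B &
    A `<=` B /\ exists r, B (y0, r).
Proof.
move=> M0 AP; have [A0 AD AZ Ale] := AP.
pose E := [set u.2 - M * rnorm (u.1 - y0) | u in A].
have key u v : A u -> A v ->
    u.2 - M * rnorm (u.1 - y0) <= M * rnorm (v.1 + y0) - v.2.
  move=> Au Av; rewrite lerBrDr addrAC lerBlDr.
  apply: le_trans (Ale _ (AD _ _ Au Av)) _ => /=.
  rewrite -mulrDr ler_wpM2l//.
  have -> : u.1 + v.1 = (v.1 + y0) + (u.1 - y0) by rewrite addrACA subrr addr0 addrC.
  exact: ler_rnormD.
have E0 : E !=set0 by exists (0 - M * rnorm (0 - y0)); exists (0, 0).
have Eub : has_ubound E.
  exists (M * rnorm (0 + y0) - 0) => _ [u Au <-]; exact: (key u (0, 0)).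
(* The least admissible value at [y0]. *)
pose r0 := sup E.
have r0ge u : A u -> u.2 - M * rnorm (u.1 - y0) <= r0.
  by move=> Au; apply: ub_le_sup => //; exists u.
have r0le v : A v -> r0 <= M * rnorm (v.1 + y0) - v.2.
  by move=> Av; apply: ge_sup => // _ [u Au <-]; exact: key.
exists [set w | exists u t, A u /\ w = (u.1 + rC t *: y0, u.2 + t * r0)]; last first.
  split; last first.
    by exists r0; exists (0, 0), 1; split => //=; rewrite rC1 scale1r mul1r !add0r.
  by move=> [y r] Ayr; exists (y, r), 0; split => //=; rewrite rC0 scale0r mul0r !addr0.
split.
- by exists (0, 0), 0; split => //=; rewrite rC0 scale0r mul0r !addr0.
- move=> _ _ [u [s [Au ->]]] [v [t [Av ->]]] /=.
  exists (u.1 + v.1, u.2 + v.2), (s + t); split; first exact: AD.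
  by rewrite /= rCD scalerDl mulrDl addrACA [X in (_, X)]addrACA.
- move=> t _ [u [s [Au ->]]] /=.
  exists (rC t *: u.1, t * u.2), (t * s); split; first exact: AZ.
  by rewrite /= rCM scalerDr scalerA mulrDr mulrA.
move=> _ [u [t [Au ->]]] /=.
(* Dividing by [|t|] reduces to the coefficients -1 and 1 of [y0], which are [r0ge] and [r0le]. *)
have [t0|t0|->] := ltgtP t 0; last by rewrite rC0 scale0r mul0r !addr0; exact: Ale.
- have tp : 0 < - t by rewrite oppr_gt0.
  have := r0ge _ (AZ (- t)^-1 _ Au); rewrite /=.
  have -> : rC ((- t)^-1) *: u.1 - y0 = rC ((- t)^-1) *: (u.1 + rC t *: y0).
    rewrite scalerDr scalerA -rCM invrN mulNr mulVf ?lt_eqF//.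
    by rewrite !rCN rC1 scaleN1r.
  rewrite rnormZ rnorm_rC ger0_norm ?invr_ge0 ?(ltW tp)// mulrCA -mulrBr.
  rewrite ler_pdivrMl// mulNr lerBlDr => h.
  by rewrite -lerBrDr addrC.
- have := r0le _ (AZ t^-1 _ Au); rewrite /=.
  have -> : rC (t^-1) *: u.1 + y0 = rC (t^-1) *: (u.1 + rC t *: y0).
    by rewrite scalerDr scalerA -rCM mulVf ?gt_eqF// rC1 scale1r.
  rewrite rnormZ rnorm_rC ger0_norm ?invr_ge0 ?(ltW t0)// mulrCA -mulrBr.
  by rewrite ler_pdivlMl// lerBrDr addrC.
Qed.

Lemma real_hahn_banach M (G0 : set (Y * R)) : 0 <= M ->
  real_dominated_graph M G0 -> exists u : Y -> R,
    [/\ forall x y, u (x + y) = u x + u y,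
        forall t x, u (rC t *: x) = t * u x,
        forall x, u x <= M * rnorm x
      & forall x r, G0 (x, r) -> u x = r].
Proof.
move=> M0 G0P.
have [A [AP Amax]] : exists A, real_dominated_graph M (A `|` G0) /\
    forall B, A `<` B -> ~ real_dominated_graph M (B `|` G0).
  (* [G0] is adjoined to each graph so that the empty chain is bounded. *)
  apply: (@Zorn_bigcup _ [set A | real_dominated_graph M (A `|` G0)]) => F FP Ftot.
  exact: real_dominated_graph_bigcup.
(* The maximal graph is total: its extension B through y already contains [G0], hence is admissible
   and by maximality equals A. *)
have tot y : exists r, (A `|` G0) (y, r).
  have [B BP [AB [r Br]]] := real_dominated_graph_extend y M0 AP.
  exists r; suff BA : B `<=` A by left; apply: BA.
  move: (Amax B); rewrite properEneq.
  have -> : B `|` G0 = B.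
    by apply/setUidPl => w G0w; apply: AB; right.
  move=> h; have {h} : ~ (A != B /\ A `<=` B) by move=> /h; exact.
  move=> /not_andP[/negP|]; first by rewrite negbK => /eqP ->.
  by move=> h; exfalso; apply: h => w Aw; apply: AB; left.
have [u uP] := choice tot.
have Afun x r : (A `|` G0) (x, r) -> u x = r.
  by move=> h; exact: (real_dominated_graph_fun AP (uP x) h).
have [A0 AD AZ Ale] := AP; exists u; split.
- move=> x y; apply: Afun; exact: (AD (x, u x) (y, u y)).
- move=> t x; apply: Afun; exact: (AZ t (x, u x)).
- by move=> x; exact: (Ale (x, u x)).
- by move=> x r G0x; apply: Afun; right.
Qed.

(** The real part of [phi] is extended by the real theorem, and a complex functional is recovered
    from its real part. The subspace is given as the image of an isometry [j], as in [projconst]. *)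
Lemma hahn_banach_cplx (X : normedModType (Cplx R)) (j : {linear X -> Y})
    (phi : X -> Cplx R) (M : R) :
  (forall x, `|j x| = `|x|) -> 0 <= M ->
  (forall a x y, phi (a *: x + y) = a * phi x + phi y) ->
  (forall x, rnorm (phi x) <= M * rnorm x) ->
  exists psi : Y -> Cplx R,
    [/\ forall a x y, psi (a *: x + y) = a * psi x + psi y,
        forall y, rnorm (psi y) <= M * rnorm y
      & forall x, psi (j x) = phi x].
Proof.
move=> jiso M0 philin phile.
have phi0 : phi 0 = 0.
  by have := philin (-1) 0 0; rewrite scaler0 addr0 mulN1r addNr.
have phiD x y : phi (x + y) = phi x + phi y.
  by have := philin 1 x y; rewrite scale1r mul1r.
have phiZ a x : phi (a *: x) = a * phi x.
  by have := philin a x 0; rewrite !addr0 phi0 addr0.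
pose G0 : set (Y * R) := [set w | exists x, w = (j x, cre (phi x))].
have G0P : real_dominated_graph M G0.
  split.
  - by exists 0; rewrite linear0 phi0.
  - by move=> _ _ [x ->] [y ->]; exists (x + y); rewrite linearD phiD creD.
  - move=> t _ [x ->]; exists (rC t *: x).
    by rewrite linearZ phiZ creM cim_rC mul0r subr0.
  - move=> _ [x ->] /=; apply: le_trans (_ : rnorm (phi x) <= _).
      exact: le_trans (ler_norm _) (cre_le_rnorm _).
    by have := phile x; rewrite /rnorm jiso.
have [u [uD uZ ule uG0]] := real_hahn_banach M0 G0P.
pose I : Cplx R := ('i%C : R[i]).
have II : I * I = -1 by apply: cplxP; rewrite /cre /cim /=; lra.
have uN x : u (- x) = - u x.
  have := uZ (-1) x; rewrite mulN1r => <-; congr u.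
  by rewrite rCN rC1 scaleN1r.
(* A complex-linear functional with real part u must be [u y - i * u (i y)]. *)
pose psi (y : Y) : Cplx R := ((u y) -i* (u (I *: y)))%C.
have psi_re y : cre (psi y) = u y by [].
have psi_im y : cim (psi y) = - u (I *: y) by [].
have psiD x y : psi (x + y) = psi x + psi y.
  by apply: cplxP; rewrite ?creD ?cimD /cre /cim /= ?scalerDr !uD // opprD.
have aE (a : Cplx R) : a = rC (cre a) + rC (cim a) * I.
  by apply: cplxP; rewrite ?creD ?cimD ?creM ?cimM /cre /cim /=; lra.
have psiZ a y : psi (a *: y) = a * psi y.
  have ua : forall z, u (a *: z) = cre a * u z + cim a * u (I *: z).
    by move=> z; rewrite {1}(aE a) scalerDl uD uZ -scalerA uZ.
  apply: cplxP; rewrite ?creM ?cimM !(psi_re, psi_im).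
    by rewrite mulrN opprK ua.
  rewrite scalerA mulrC -scalerA ua scalerA II scaleN1r uN.
  by rewrite !mulrN opprD opprK.
exists psi; split.
- by move=> a x y; rewrite psiD psiZ.
(* The bound on u is applied to [(psi y)^* *: y], where [psi] takes the real value [|psi y|^2]; one
   factor [|psi y|] then cancels. *)
- move=> y; have [->|psi0] := eqVneq (rnorm (psi y)) 0.
    by rewrite mulr_ge0 ?rnorm_ge0.
  have {}psi0 : 0 < rnorm (psi y) by rewrite lt_def psi0 rnorm_ge0.
  have := ule ((psi y)^* *: y); rewrite rnormZ rnorm_conj -psi_re psiZ.
  rewrite mulrC normCKr cre_rC expr2 mulrCA.
  by rewrite ler_pM2l.
- move=> x; apply: cplxP.
    by rewrite psi_re; apply: uG0; exists x.
  rewrite psi_im -linearZ (uG0 _ (cre (phi (I *: x)))); last by exists (I *: x).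
  by rewrite phiZ creM /I {1}/cre {1}/cim /=; lra.
Qed.

End hahn_banach.

(** * Integration of continuous functions *)

Section complex_continuity.
Context {R : realType}.
Local Notation C := (Cplx R).

Lemma continuous_cplx (T : topologicalType) (f : T -> C) (x : T) :
  (forall e : R, 0 < e -> \forall y \near x, rnorm (f x - f y) < e) ->
  {for x, continuous f}.
Proof.
move=> h; apply/(@cvgrPdist_lt _ C _ _ (nbhs_filter x)) => _ /gt0_rC[e e0 ->].
have := h _ e0; apply: filterS => y.
by rewrite normC_rnorm rC_lt.
Qed.

Lemma continuous_cplx_near (T : topologicalType) (f : T -> C) (x : T) (e : R) :
  {for x, continuous f} -> 0 < e -> \forall y \near x, rnorm (f x - f y) < e.
Proof.
move=> /(@cvgrPdist_lt _ C _ _ (nbhs_filter x)) h e0.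
have := h (rC e); rewrite -rC0 rC_lt => /(_ e0).
by apply: filterS => y; rewrite normC_rnorm rC_lt.
Qed.

Lemma continuous_cre : continuous (@cre R : C -> R).
Proof.
move=> z; apply/(@cvgrPdist_lt _ _ _ _ (nbhs_filter z)) => e e0.
have := continuous_cplx_near (@cvg_id _ (nbhs z)) e0; apply: filterS => t /=.
apply: le_lt_trans; rewrite -creN -creD; exact: cre_le_rnorm.
Qed.

Lemma continuous_cim : continuous (@cim R : C -> R).
Proof.
move=> z; apply/(@cvgrPdist_lt _ _ _ _ (nbhs_filter z)) => e e0.
have := continuous_cplx_near (@cvg_id _ (nbhs z)) e0; apply: filterS => t /=.
apply: le_lt_trans; rewrite -cimN -cimD; exact: cim_le_rnorm.
Qed.

Lemma continuous_rC : continuous (@rC R : R -> C).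
Proof.
move=> x; apply: continuous_cplx => e e0.
have /(@cvgrPdist_lt _ _ _ _ (nbhs_filter x))/(_ _ e0) := (@cvg_id _ (nbhs x)).
by apply: filterS => y /=; rewrite -rCN -rCD rnorm_rC.
Qed.

Lemma continuous_conjC : continuous (fun z : C => z^*).
Proof.
move=> z; apply: continuous_cplx => e e0.
have := continuous_cplx_near (@cvg_id _ (nbhs z)) e0; apply: filterS => t /=.
by rewrite -rmorphB rnorm_conj.
Qed.

Context {T : topologicalType}.
Implicit Types f g : T -> C.

Lemma continuous_cconj f : continuous f -> continuous (fun x => (f x)^*).
Proof. by move=> cf x; apply: continuous_comp (cf x) (@continuous_conjC _). Qed.

Lemma continuous_cM f g : continuous f -> continuous g ->
  continuous (fun x => f x * g x).
Proof. by move=> cf cg x; apply: cvgM; [exact: cf|exact: cg]. Qed.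

Lemma continuous_cZ (a : C) f : continuous f -> continuous (fun x => a * f x).
Proof. move=> cf; apply: (@continuous_cM (fun=> a) f); last exact: cf.
by move=> x; exact: (@cvg_cst C). Qed.

Lemma continuous_csum (I : Type) (s : seq I) (P : pred I) (F : I -> T -> C) :
  (forall i, continuous (F i)) -> continuous (fun x => \sum_(i <- s | P i) F i x).
Proof.
move=> cF x; apply: cvg_big => [|i _]; [exact: add_continuous|exact: cF].
Qed.

Lemma continuous_rnorm_fun f : continuous f -> continuous (fun x => rnorm (f x) : R).
Proof.
move=> cf x; apply: (@continuous_comp _ _ _ f (fun z : C => rnorm z : R)).
  exact: cf.
exact: rnorm_continuous.
Qed.

Lemma continuous_rC_fun (f : T -> R) : continuous f -> continuous (fun x => rC (f x)).
Proof.
move=> cf x; apply: (@continuous_comp _ _ _ f (@rC R)); first exact: cf.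
exact: continuous_rC.
Qed.

Lemma continuous_cre_fun f : continuous f -> continuous (fun x => cre (f x)).
Proof.
move=> cf x; apply: (@continuous_comp _ _ _ f (@cre R)); first exact: cf.
exact: continuous_cre.
Qed.

Lemma continuous_cim_fun f : continuous f -> continuous (fun x => cim (f x)).
Proof.
move=> cf x; apply: (@continuous_comp _ _ _ f (@cim R)); first exact: cf.
exact: continuous_cim.
Qed.

End complex_continuity.

Section translations.
Context {G : compactGroupType}.

Lemma continuous_mulg_fun (T : topologicalType) (f g : T -> G) :
  continuous f -> continuous g -> continuous (fun x => (f x * g x)%g).
Proof.
move=> cf cg x; apply: (@continuous_comp _ _ _ (fun x => (f x, g x))
  (fun p : G * G => (p.1 * p.2)%g)); last exact: mulg_continuous.
by apply: cvg_pair; [exact: cf|exact: cg].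
Qed.

Lemma continuous_invg_fun (T : topologicalType) (f : T -> G) :
  continuous f -> continuous (fun x => (f x)^-1%g).
Proof.
by move=> cf x; apply: (@continuous_comp _ _ _ f (fun x : G => x^-1%g));
  [exact: cf|exact: invg_continuous].
Qed.

Lemma continuous_fst_prod : continuous (fun p : G * G => p.1).
Proof. by move=> p; exact: cvg_fst. Qed.

Lemma continuous_snd_prod : continuous (fun p : G * G => p.2).
Proof. by move=> p; exact: cvg_snd. Qed.

Lemma continuous_mulgl (a : G) : continuous (fun x : G => (a * x)%g).
Proof. by apply: continuous_mulg_fun => x; [exact: cvg_cst|exact: cvg_id]. Qed.

Lemma continuous_compose (S T U : topologicalType) (f : S -> T) (g : T -> U) :
  continuous f -> continuous g -> continuous (fun x => g (f x)).
Proof. by move=> cf cg x; apply: continuous_comp; [exact: cf|exact: cg]. Qed.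

Lemma continuous_ldiv_fun (T : topologicalType) (f : G -> T) :
  continuous f -> continuous (fun yx : G * G => f (yx.1^-1 * yx.2)%g).
Proof.
move=> cf; apply: (@continuous_compose _ _ _ (fun yx : G * G => yx.1^-1 * yx.2)%g f) => //.
apply: continuous_mulg_fun; last exact: continuous_snd_prod.
by apply: continuous_invg_fun; exact: continuous_fst_prod.
Qed.

Lemma continuous_fst_fun (T : topologicalType) (f : G -> T) :
  continuous f -> continuous (fun yx : G * G => f yx.1).
Proof.
move=> cf; apply: (@continuous_compose _ _ _ (fun yx : G * G => yx.1) f) => //.
exact: continuous_fst_prod.
Qed.

Lemma continuous_slice1 (T : topologicalType) (F : G * G -> T) (x : G) :
  continuous F -> continuous (fun y => F (y, x)).
Proof.
move=> cF; apply: continuous_compose cF => y.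
by apply: cvg_pair; [exact: cvg_id|exact: cvg_cst].
Qed.

Lemma continuous_slice2 (T : topologicalType) (F : G * G -> T) (x : G) :
  continuous F -> continuous (fun y => F (x, y)).
Proof.
move=> cF; apply: continuous_compose cF => y.
by apply: cvg_pair; [exact: cvg_cst|exact: cvg_id].
Qed.

Lemma compact_finite_cover (U : G -> set G) :
  (forall y, open (U y)) -> (forall y, U y y) ->
  exists s : seq G, forall x, exists2 y, y \in s & U y x.
Proof.
move=> oU Uy; have := @compact_setT G; rewrite compact_cover.
move=> /(_ G setT U (fun y _ => oU y)) [|D _ cD].
  by move=> x _; exists x.
exists D => x; have [y yD Uyx] := cD x I.
by exists y.
Qed.

End translations.

Section tube.
Context {R : realType} {G : compactGroupType}.

(** Tube lemma: compactness of G in the variable x makes the continuity in y uniform in x. *)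
Lemma continuous_tube (F : G * G -> R) (y : G) (e : R) : continuous F -> 0 < e ->
  \forall y' \near y, forall x, `|F (y, x) - F (y', x)| < e.
Proof.
move=> cF e0.
have /compact_near_coveringP := @compact_setT G.
move=> /(_ G (nbhs y) (fun y' x => `|F (y, x) - F (y', x)| < e)).
move=> /(_ (nbhs_filter y)) h.
have : \forall y' \near y, [set: G] `<=` [set x | `|F (y, x) - F (y', x)| < e].
  apply: h => x _.
  have e2 : 0 < e / 2 by rewrite divr_gt0.
  have /(@cvgrPdist_lt _ _ _ _ (nbhs_filter (y, x)))/(_ _ e2) := cF (y, x).
  case=> /= -[A B] /= [yA xB] AB.
  exists (B, A) => //= -[x' y'] /= [Bx' Ay'].
  have h1 := AB (y', x') (conj Ay' Bx').
  have h2 := AB (y, x') (conj (nbhs_singleton yA) Bx').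
  rewrite /= in h1 h2.
  have -> : F (y, x') - F (y', x') = (F (y, x) - F (y', x')) - (F (y, x) - F (y, x')).
    by ring.
  apply: le_lt_trans (ler_normB _ _) _.
  by rewrite (splitr e) ltrD.
by apply: filterS => y' hy x; exact: hy.
Qed.

End tube.

(** * Real integrals over the group and uniform quadrature *)

Section real_integral.
Context {R : realType} {G : compactGroupType}.
Variable mu : probability (borelType G) R.

Definition mean (f : G -> R) : R := \int[mu]_x (f x).

Lemma open_borel (U : set G) : open U -> measurable (U : set (borelType G)).
Proof. by move=> oU; apply: sub_sigma_algebra. Qed.

Lemma continuous_borel_measurable (f : G -> R) : continuous f ->
  measurable_fun [set: borelType G] (f : borelType G -> R).
Proof.
move=> /continuousP cf; apply: (measurability _ (RGenOpens.measurableE R)).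
move=> _ [_ [a [b ->] <-]]; rewrite setTI; apply: open_borel.
exact/cf/interval_open.
Qed.

Lemma compactG_bounded (f : G -> R) : continuous f -> exists M : R, forall x, `|f x| <= M.
Proof.
move=> cf.
have /compact_bounded/pinfty_ex_gt0[M _ hM] : compact (f @` [set: G]).
  apply: continuous_compact; last exact: compact_setT.
  exact: continuous_subspaceT.
by exists M => x; apply: hM; exists x.
Qed.

Lemma probability_lty : (mu [set: borelType G] < +oo)%E.
Proof. by rewrite probability_setT ltry. Qed.

(** Integrability is tracked rather than continuity because the quadrature rule integrates
    indicators of Borel pieces. *)
Definition bintegrable (f : G -> R) :=
  mu.-integrable [set: borelType G] (EFin \o f).

Lemma continuous_bintegrable f : continuous f -> bintegrable f.
Proof.
move=> cf; apply: measurable_bounded_integrable => //.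
- exact: probability_lty.
- exact: continuous_borel_measurable.
- have [M hM] := compactG_bounded cf.
  exists M; split; first exact: num_real.
  by move=> N MN x _; apply: le_trans (hM x) (ltW MN).
Qed.

Lemma bintegrableD f g : bintegrable f -> bintegrable g ->
  bintegrable (fun x => f x + g x).
Proof. by move=> fi gi; exact: (integrableD measurableT fi gi). Qed.

Lemma bintegrableZ a f : bintegrable f -> bintegrable (fun x => a * f x).
Proof. by move=> fi; exact: (integrableZl measurableT a fi). Qed.

Lemma mean_D f g : bintegrable f -> bintegrable g ->
  mean (fun x => f x + g x) = mean f + mean g.
Proof. by move=> fi gi; exact: (RintegralD measurableT fi gi). Qed.

Lemma mean_Z a f : bintegrable f -> mean (fun x => a * f x) = a * mean f.
Proof. by move=> fi; exact: RintegralZl. Qed.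

Lemma mean_cst c : mean (fun _ => c) = c.
Proof.
rewrite /mean Rintegral_cst// -[RHS]mulr1; congr (_ * _).
by have /(congr1 fine) := probability_setT mu.
Qed.

Lemma mean_le f g : bintegrable f -> bintegrable g -> (forall x, f x <= g x) ->
  mean f <= mean g.
Proof. by move=> fi gi fg; apply: le_Rintegral. Qed.

Lemma eq_mean f g : f =1 g -> mean f = mean g.
Proof. by move=> fg; congr mean; apply/funext. Qed.

Lemma mean_sum n (F : 'I_n -> G -> R) : (forall i, bintegrable (F i)) ->
  bintegrable (fun x => \sum_i F i x) /\
  mean (fun x => \sum_i F i x) = \sum_i mean (F i).
Proof.
elim: n F => [|n IH] F Fi.
  have -> : (fun x : G => \sum_(i < 0) F i x) = (fun _ => 0).
    by apply/funext => x; rewrite big_ord0.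
  rewrite big_ord0 mean_cst; split => //.
  by apply: continuous_bintegrable => x; exact: cvg_cst.
have -> : (fun x : G => \sum_(i < n.+1) F i x) =
    (fun x => F ord0 x + \sum_(i < n) F (lift ord0 i) x).
  by apply/funext => x; rewrite big_ord_recl.
have [Ii IE] := IH (fun i => F (lift ord0 i)) (fun i => Fi _).
rewrite big_ord_recl -IE; split; first exact: bintegrableD.
exact: mean_D.
Qed.

Lemma mean_dist_le f g (e : R) : bintegrable f -> bintegrable g ->
  (forall x, `|f x - g x| <= e) -> `|mean f - mean g| <= e.
Proof.
move=> fi gi fge.
have ei : bintegrable (fun _ => e) by apply: continuous_bintegrable => x; exact: cvg_cst.
have eNi : bintegrable (fun _ => - e).
  by apply: continuous_bintegrable => x; exact: cvg_cst.
have le u v : bintegrable u -> bintegrable v -> (forall x, `|u x - v x| <= e) ->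
    mean u - mean v <= e.
  move=> ui vi uve; rewrite lerBlDl -(mean_cst e) -mean_D//.
  apply: mean_le => //; first exact: bintegrableD.
  by move=> x; rewrite -lerBlDl; apply: le_trans (uve x); exact: ler_norm.
rewrite ler_norml le// andbT lerNl opprB le// => x.
by rewrite distrC.
Qed.

Lemma mean_le_cst f (e : R) : bintegrable f -> (forall x, `|f x| <= e) -> `|mean f| <= e.
Proof.
move=> fi fe; rewrite -[mean f]subr0 -(mean_cst 0).
apply: mean_dist_le => //; last by move=> x; rewrite subr0.
by apply: continuous_bintegrable => x; exact: cvg_cst.
Qed.

(** G is cut into finitely many Borel pieces, on each of which every [F i (., x)] stays within e of
    its value at a node, uniformly in x. The weights are the measures of the pieces, so the rule
    depends neither on i nor on x. *)
Lemma mean_quadrature (I : finType) (F : I -> G * G -> R) (e : R) :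
  (forall i, continuous (F i)) -> 0 < e ->
  exists n (y : 'I_n -> G) (w : 'I_n -> R), (forall j, 0 <= w j) /\
    forall i x, `|\sum_j w j * F i (y j, x) - mean (fun t => F i (t, x))| <= e.
Proof.
move=> cF e0.
pose V y := [set y' | forall i, forall x, `|F i (y, x) - F i (y', x)| < e].
have nV y : nbhs y (V y).
  by apply: filter_forall => i; exact: continuous_tube.
pose U (y : G) : set G := interior (V y).
have [|y|s sP] := @compact_finite_cover G U; first by move=> y; exact: open_interior.
  by apply: nV.
(* A point goes to the first node whose neighbourhood contains it; this makes the finite open cover
   a partition. *)
pose idx (x : G) := find (fun y => x \in U y) s.
have idx_lt x : (idx x < size s)%N.
  rewrite -has_find; have [y ys Ux] := sP x.
  by apply/hasP; exists y => //; rewrite inE.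
pose y (j : 'I_(size s)) := nth point s j.
pose A (j : 'I_(size s)) : set (borelType G) := [set x | idx x = j].
have UA x : U (nth point s (idx x)) x.
  have /(nth_find point) : has (fun y => x \in U y) s by rewrite has_find; exact: idx_lt.
  by rewrite inE.
have mfind (s' : seq G) k :
    measurable ([set x | find (fun y => x \in U y) s' = k] : set (borelType G)).
  elim: s' k => [|z s' IH] k /=.
    have [<-|k0] := eqVneq 0%N k.
      by rewrite (_ : [set _ | _] = setT)//; apply/seteqP; split.
    rewrite (_ : [set _ | _] = set0)//; apply/seteqP; split => // x /= k0'.
    by rewrite k0' eqxx in k0.
  have mU : measurable (U z : set (borelType G)) by apply: open_borel; exact: open_interior.
  case: k => [|k].
    rewrite (_ : [set _ | _] = U z)//; apply/seteqP; split => x /=.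
      by case: ifP => // /set_mem.
    by move=> /mem_set ->.
  rewrite (_ : [set _ | _] = ~` (U z) `&` [set x | find (fun y => x \in U y) s' = k]).
    by apply: measurableI (IH k); exact: measurableC.
  apply/seteqP; split => x /=.
    by case: ifPn => // /negP Ux [<-]; split => // /mem_set.
  by move=> [Ux <-]; case: ifP => // /set_mem.
have mA j : measurable (A j) by exact: mfind.
have indI j : bintegrable (\1_(A j) : G -> R) by exact: integrable_indic.
have indE j : mean (\1_(A j) : G -> R) = fine (mu (A j)).
  by rewrite /mean /Rintegral integral_indic// setIT.
exists (size s), y, (fun j => fine (mu (A j))); split.
  by move=> j; rewrite fine_ge0.
move=> i x.
pose S j := fun t : G => F i (y j, x) * \1_(A j) t.
have SI j : bintegrable (S j) by exact: bintegrableZ.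
have [sumI sumE] := mean_sum SI.
have -> : \sum_j fine (mu (A j)) * F i (y j, x) = mean (fun t => \sum_j S j t).
  by rewrite sumE; apply: eq_bigr => j _; rewrite mean_Z// indE mulrC.
apply: mean_dist_le => //.
  by apply: continuous_bintegrable; exact: continuous_slice1.
(* Only the piece containing t contributes to the step function at t. *)
move=> t; rewrite (bigD1 (Ordinal (idx_lt t)))//= big1 ?addr0 => [|j /eqP jt]; last first.
  rewrite /S indicE memNset ?mulr0// => tj; apply: jt.
  by apply: val_inj; rewrite /= tj.
rewrite /S indicE mem_set// mulr1.
have := UA t; move=> /(@interior_subset _ _ _); rewrite /V /= => /(_ i x) h.
by apply: ltW; rewrite /y /=.
Qed.

Lemma mean_ge0 f : (forall x, 0 <= f x) -> 0 <= mean f.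
Proof. by move=> f0; exact: Rintegral_ge0. Qed.

Section haar.
Hypothesis haar : is_haar mu.

Lemma mean_mull (a : G) (f : G -> R) : continuous f -> mean (fun x => f (a * x)%g) = mean f.
Proof.
move=> cf; have [left _ _] := haar.
pose phi (x : borelType G) : borelType G := (a * x : G)%g.
have mphi : measurable_fun [set: borelType G] phi.
  apply: (measurability _ (erefl (@measurable _ (borelType G)))).
  move=> _ [U oU <-]; rewrite setTI; apply: open_borel.
  have /continuousP : continuous (fun x : G => (a * x)%g) by exact: continuous_mulgl.
  exact.
have /measurable_EFinP mf := continuous_borel_measurable cf.
have cfa : continuous (fun x => f (a * x)%g).
  exact: (continuous_compose (@continuous_mulgl _ a) cf).
have inta := continuous_bintegrable cfa.
rewrite /mean /Rintegral; congr fine.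
have := @integral_pushforward _ _ _ _ R phi mphi mu setT _ mf.
rewrite preimage_setT => /(_ inta measurableT) => /esym ->.
apply: eq_measure_integral => A mA _.
(* Invariance speaks of images and the pushforward of preimages; the preimage of A under translation
   by a is its image under translation by [a^-1]. *)
rewrite /pushforward -(left a^-1%g A mA); congr (mu _).
apply/seteqP; split => x /=.
  by move=> Aax; exists (a * x)%g => //; rewrite mulKg.
by move=> [z Az <-]; rewrite /phi mulVKg.
Qed.

(** Haar measure has full support: by compactness finitely many translates of f add up to at least
    [f x0 / 2] everywhere, while by invariance their sum would have mean 0 if f had. *)
Lemma mean_gt0 (f : G -> R) x0 : continuous f ->
  (forall x, 0 <= f x) -> 0 < f x0 -> 0 < mean f.
Proof.
move=> cf f0 fx0; rewrite lt_neqAle mean_ge0// andbT; apply/negP => /eqP If.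
pose c := f x0 / 2.
have c0 : 0 < c by rewrite divr_gt0.
pose U (y : G) : set G := [set x | c < f (x0 * y^-1 * x)%g].
have cfy y : continuous (fun x => f (x0 * y^-1 * x)%g).
  exact: (continuous_compose (@continuous_mulgl _ _) cf).
have [y|y|s sP] := @compact_finite_cover G U.
- have /continuousP h := cfy y.
  by apply: (h [set t | c < t]); exact: open_gt.
- by rewrite /U /= mulgVK /c ltr_pdivrMr// mulr_natr mulr2n ltrDl.
pose F (j : 'I_(size s)) := fun x => f (x0 * (nth point s j)^-1 * x)%g.
have FI j : bintegrable (F j) by apply: continuous_bintegrable; exact: cfy.
have [FsI FsE] := mean_sum FI.
have : c <= mean (fun x => \sum_j F j x).
  rewrite -{1}(mean_cst c); apply: mean_le => //.
    by apply: continuous_bintegrable => x; exact: cvg_cst.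
  move=> x; have [z /(nthP point)[k ks <-] Uz] := sP x.
  rewrite (bigD1 (Ordinal ks))//=; apply: le_trans (ltW Uz) _.
  by rewrite lerDl; apply: sumr_ge0 => j _; exact: f0.
rewrite FsE big1 ?leNgt ?c0// => j _.
by rewrite /F mean_mull.
Qed.

End haar.
End real_integral.

(** * Linear spans *)

Section lspan_theory.
Context {K : nzRingType} {V : lmodType K}.
Implicit Types A : set V.

Lemma lspan0 A : lspan A 0.
Proof. by exists 0%N, (fun=> 0), (fun=> 0); split; [case|rewrite big_ord0]. Qed.

Lemma lspan_mem A x : A x -> lspan A x.
Proof.
by move=> Ax; exists 1%N, (fun=> 1), (fun=> x); rewrite big_ord1 scale1r.
Qed.

Lemma lspanD A x y : lspan A x -> lspan A y -> lspan A (x + y).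
Proof.
move=> [n [c [a [aA ->]]]] [m [d [b [bA ->]]]].
exists (n + m)%N,
  (fun i : 'I_(n + m) => match fintype.split i with inl j => c j | inr k => d k end),
  (fun i : 'I_(n + m) => match fintype.split i with inl j => a j | inr k => b k end).
split; first by move=> i; case: fintype.split.
rewrite big_split_ord /=; congr (_ + _); apply: eq_bigr => i _.
  by rewrite (unsplitK (inl _ i)).
by rewrite (unsplitK (inr _ i)).
Qed.

Lemma lspanZ A (k : K) x : lspan A x -> lspan A (k *: x).
Proof.
move=> [n [c [a [aA ->]]]]; exists n, (fun i => k * c i), a; split => //.
by rewrite scaler_sumr; apply: eq_bigr => i _; rewrite scalerA.
Qed.

Lemma lspan_sum A (I : Type) (r : seq I) (P : pred I) (F : I -> V) :
  (forall i, lspan A (F i)) -> lspan A (\sum_(i <- r | P i) F i).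
Proof.
move=> AF; elim/big_rec: _ => [|i x _ Ax]; first exact: lspan0.
exact: lspanD.
Qed.

Lemma lspan_min A (B : set V) : B 0 -> (forall x y, B x -> B y -> B (x + y)) ->
  (forall k x, B x -> B (k *: x)) -> A `<=` B -> lspan A `<=` B.
Proof.
move=> B0 BD BZ AB _ [n [c [a [aA ->]]]].
by apply: (big_ind B) => // i _; apply: BZ; exact: AB.
Qed.

Lemma lspanS A B : A `<=` B -> lspan A `<=` lspan B.
Proof.
move=> AB; apply: lspan_min; [exact: lspan0|exact: lspanD|exact: lspanZ|].
by move=> x /AB; exact: lspan_mem.
Qed.

End lspan_theory.

(** * Complex integrals and the inner product of square-integrable functions *)

Section complex_integral.
Context {R : realType} {G : compactGroupType}.
Variable mu : probability (borelType G) R.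
Local Notation C := (Cplx R).
Implicit Types f g : G -> C.
Local Notation mean := (mean mu).

Definition cmean f : C := (mean (fun x => cre (f x)) +i* mean (fun x => cim (f x)))%C.

Lemma cre_cmean f : cre (cmean f) = mean (fun x => cre (f x)). Proof. by []. Qed.
Lemma cim_cmean f : cim (cmean f) = mean (fun x => cim (f x)). Proof. by []. Qed.

Lemma bintegrable_cre f : continuous f -> bintegrable mu (fun x => cre (f x)).
Proof. by move=> cf; apply: continuous_bintegrable; exact: continuous_cre_fun. Qed.

Lemma bintegrable_cim f : continuous f -> bintegrable mu (fun x => cim (f x)).
Proof. by move=> cf; apply: continuous_bintegrable; exact: continuous_cim_fun. Qed.

Lemma eq_cmean f g : f =1 g -> cmean f = cmean g.
Proof. by move=> fg; congr cmean; apply/funext. Qed.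

Lemma cmean_D f g : continuous f -> continuous g ->
  cmean (fun x => f x + g x) = cmean f + cmean g.
Proof.
move=> cf cg; apply: cplxP; rewrite ?creD ?cimD ?(cre_cmean, cim_cmean).
- rewrite -mean_D; [|exact: bintegrable_cre|exact: bintegrable_cre].
  by apply: eq_mean => x; rewrite creD.
- rewrite -mean_D; [|exact: bintegrable_cim|exact: bintegrable_cim].
  by apply: eq_mean => x; rewrite cimD.
Qed.

Lemma cmean_Z (a : C) f : continuous f -> cmean (fun x => a * f x) = a * cmean f.
Proof.
move=> cf; have If := bintegrable_cre cf; have Jf := bintegrable_cim cf.
have IZ (b : R) (h : G -> R) := @bintegrableZ R G mu b h.
apply: cplxP; rewrite ?creM ?cimM !(cre_cmean, cim_cmean).
- rewrite -mulNr -!mean_Z// -mean_D; [|exact: IZ|exact: IZ].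
  by apply: eq_mean => x; rewrite creM mulNr.
- rewrite -!mean_Z// -mean_D; [|exact: IZ|exact: IZ].
  by apply: eq_mean => x; rewrite cimM.
Qed.

Lemma cmean_cst (c : C) : cmean (fun=> c) = c.
Proof. by apply: cplxP; rewrite ?(cre_cmean, cim_cmean) mean_cst. Qed.

Lemma cmean_sum (I : Type) (r : seq I) (P : pred I) (F : I -> G -> C) :
  (forall i, continuous (F i)) ->
  cmean (fun x => \sum_(i <- r | P i) F i x) = \sum_(i <- r | P i) cmean (F i).
Proof.
move=> cF; elim: r => [|i r IH].
  rewrite big_nil -[RHS](cmean_cst 0); apply: eq_cmean => x.
  by rewrite big_nil.
rewrite big_cons -IH; case: ifPn => Pi; last first.
  by apply: eq_cmean => x; rewrite big_cons (negbTE Pi).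
rewrite -cmean_D//; last exact: continuous_csum.
by apply: eq_cmean => x; rewrite big_cons Pi.
Qed.

Lemma cmean_conj f : continuous f -> cmean (fun x => (f x)^*) = (cmean f)^*.
Proof.
move=> cf; apply: cplxP; rewrite ?cre_conj ?cim_conj ?(cre_cmean, cim_cmean).
  by apply: eq_mean => x; rewrite cre_conj.
rewrite -mulN1r -mean_Z; last exact: bintegrable_cim.
by apply: eq_mean => x; rewrite cim_conj mulN1r.
Qed.

Lemma cmean_rC (f : G -> R) : cmean (fun x => rC (f x)) = rC (mean f).
Proof.
apply: cplxP; rewrite ?(cre_cmean, cim_cmean) ?cre_rC ?cim_rC //.
by rewrite -[RHS](mean_cst mu 0); apply: eq_mean => x; rewrite cim_rC.
Qed.

(** Splitting into real and imaginary parts loses a factor 2, which is harmless: [l2dot_bound] asks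
    only for some finite constant. *)
Lemma rnorm_cmean f (e : R) : continuous f -> (forall x, rnorm (f x) <= e) ->
  rnorm (cmean f) <= e + e.
Proof.
move=> cf fe; apply: le_trans (rnorm_le_reim _) _; apply: lerD.
  apply: mean_le_cst => [|x]; first exact: bintegrable_cre.
  exact: le_trans (cre_le_rnorm _) (fe x).
apply: mean_le_cst => [|x]; first exact: bintegrable_cim.
exact: le_trans (cim_le_rnorm _) (fe x).
Qed.

Lemma cmean_quadrature (I : finType) (F : I -> G * G -> C) (e : R) :
  (forall i, continuous (F i)) -> 0 < e ->
  exists n (y : 'I_n -> G) (w : 'I_n -> R), (forall j, 0 <= w j) /\
    forall i x,
      rnorm (\sum_j rC (w j) * F i (y j, x) - cmean (fun t => F i (t, x))) <= e.
Proof.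
move=> cF e0.
(* Real and imaginary parts enter as separate members of one finite family, so that they share the
   nodes and weights. *)
pose F' (ib : I * bool) (p : G * G) : R :=
  if ib.2 then cre (F ib.1 p) else cim (F ib.1 p).
have [||n [y [w [w0 h]]]] := @mean_quadrature R G mu _ F' (e / 2).
- by move=> [i []]; [exact: continuous_cre_fun|exact: continuous_cim_fun].
- by rewrite divr_gt0.
exists n, y, w; split => // i x.
apply: le_trans (rnorm_le_reim _) _; rewrite (splitr e); apply: lerD.
  have := h (i, true) x; rewrite /F' /= => {}h.
  rewrite creD creN cre_cmean (_ : cre _ = \sum_j w j * cre (F i (y j, x)))//.
  elim/big_rec2: _ => [|j a b _ <-]; first by rewrite cre0.
  by rewrite creD creM cim_rC cre_rC mul0r subr0.
have := h (i, false) x; rewrite /F' /= => {}h.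
rewrite cimD cimN cim_cmean (_ : cim _ = \sum_j w j * cim (F i (y j, x)))//.
elim/big_rec2: _ => [|j a b _ <-]; first by rewrite cim0.
by rewrite cimD cimM cim_rC cre_rC mul0r addr0.
Qed.

Lemma continuous_cmean_param (F : G * G -> C) : continuous F ->
  continuous (fun y => cmean (fun x => F (y, x))).
Proof.
move=> cF y; apply: continuous_cplx => e e0.
have e4 : 0 < e / 4 by rewrite divr_gt0.
have h1 := continuous_tube y (continuous_cre_fun cF) e4.
have h2 := continuous_tube y (continuous_cim_fun cF) e4.
apply: filterS2 h1 h2 => y' h1 h2.
apply: le_lt_trans (rnorm_le_reim _) _.
rewrite creD cimD creN cimN !(cre_cmean, cim_cmean).
(* Integration preserves only the non-strict bounds; e / 4 for each part leaves room for the strict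
   inequality. *)
apply: (@le_lt_trans _ _ (e / 4 + e / 4)); last by lra.
apply: lerD; apply: mean_dist_le.
- by apply: bintegrable_cre; exact: continuous_slice2.
- by apply: bintegrable_cre; exact: continuous_slice2.
- by move=> x; exact/ltW/h1.
- by apply: bintegrable_cim; exact: continuous_slice2.
- by apply: bintegrable_cim; exact: continuous_slice2.
- by move=> x; exact/ltW/h2.
Qed.

Lemma cmean_mull : is_haar mu -> forall (a : G) f, continuous f ->
  cmean (fun x => f (a * x)%g) = cmean f.
Proof.
move=> haar a f cf; apply: cplxP; rewrite ?(cre_cmean, cim_cmean).
  exact: (mean_mull haar a (continuous_cre_fun cf)).
exact: (mean_mull haar a (continuous_cim_fun cf)).
Qed.

Definition l2dot (u v : cfun R G) : C := cmean (fun x => u x * (v x)^*).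

Lemma l2dot_continuous (u v : cfun R G) : continuous (fun x : G => u x * (v x)^*).
Proof.
apply: continuous_cM; first exact: cfun_continuous.
by apply: continuous_cconj; exact: cfun_continuous.
Qed.

Lemma l2dotDl u v w : l2dot (u + v) w = l2dot u w + l2dot v w.
Proof.
rewrite /l2dot -cmean_D; [|exact: l2dot_continuous|exact: l2dot_continuous].
by apply: eq_cmean => x; rewrite -mulrDl.
Qed.

Lemma l2dotZl a u w : l2dot (a *: u) w = a * l2dot u w.
Proof.
rewrite /l2dot -cmean_Z; last exact: l2dot_continuous.
by apply: eq_cmean => x; rewrite mulrA.
Qed.

Lemma l2dot_conj u v : (l2dot u v)^* = l2dot v u.
Proof.
rewrite /l2dot -cmean_conj; last exact: l2dot_continuous.
by apply: eq_cmean => x; rewrite rmorphM /= conjCK mulrC.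
Qed.

Lemma l2dot0l w : l2dot 0 w = 0.
Proof. by rewrite -(scale0r 0) l2dotZl mul0r. Qed.

Lemma l2dotDr u v w : l2dot w (u + v) = l2dot w u + l2dot w v.
Proof. by rewrite -l2dot_conj l2dotDl rmorphD /= !l2dot_conj. Qed.

Lemma l2dotZr a u w : l2dot w (a *: u) = a^* * l2dot w u.
Proof. by rewrite -l2dot_conj l2dotZl rmorphM /= !l2dot_conj. Qed.

Lemma l2dot0r w : l2dot w 0 = 0.
Proof. by rewrite -l2dot_conj l2dot0l rmorph0. Qed.

Lemma l2dotBl u v w : l2dot (u - v) w = l2dot u w - l2dot v w.
Proof. by rewrite l2dotDl -scaleN1r l2dotZl mulN1r. Qed.

Lemma l2dot_suml (I : Type) (r : seq I) (P : pred I) (F : I -> cfun R G) w :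
  l2dot (\sum_(i <- r | P i) F i) w = \sum_(i <- r | P i) l2dot (F i) w.
Proof.
by elim/big_rec2: _ => [|i a u _ <-]; [exact: l2dot0l|rewrite l2dotDl].
Qed.

Lemma l2dot_sumr (I : Type) (r : seq I) (P : pred I) (F : I -> cfun R G) w :
  l2dot w (\sum_(i <- r | P i) F i) = \sum_(i <- r | P i) l2dot w (F i).
Proof.
by elim/big_rec2: _ => [|i a u _ <-]; [exact: l2dot0r|rewrite l2dotDr].
Qed.

Lemma l2dot_sqr u : l2dot u u = rC (mean (fun x => rnorm (u x) ^+ 2)).
Proof. by rewrite -cmean_rC; apply: eq_cmean => x; rewrite normCKr. Qed.

Lemma l2dot_eq0 u : is_haar mu -> l2dot u u = 0 -> u = 0.
Proof.
move=> haar; rewrite l2dot_sqr -rC0 => /rC_inj u0.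
apply: cfunP => x; apply: rnorm_eq0; apply/eqP; rewrite -sqrf_eq0 eq_le sqr_ge0 andbT.
rewrite leNgt; apply/negP => ux.
have := @mean_gt0 R G mu haar (fun x => rnorm (u x) ^+ 2) x.
rewrite u0 ltxx => h; have {h} // : false; apply: h => //.
- have cu : continuous (fun x => rnorm (u x) : R).
    by apply: continuous_rnorm_fun; exact: cfun_continuous.
  by move=> y; apply: (@cvgM R _ _ _ _ _ _ _ (cu y) (cu y)).
- by move=> y; exact: sqr_ge0.
Qed.

(** Continuity of the coordinate functionals for the supremum norm. It lets them be extended in the
    upper bound and absorbs the quadrature error in the lower bound. *)
Lemma l2dot_bound (v : cfun R G) : exists2 B : R, 0 <= B &
  forall (u : cfun R G) M, (forall x, rnorm (u x) <= M) -> rnorm (l2dot u v) <= B * M.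
Proof.
pose N := sup (cfun_vals v).
have N0 : 0 <= N by exact: sup_cfun_vals_ge0.
exists (N + N) => [|u M uM]; first by rewrite addr_ge0.
rewrite mulrDl; apply: rnorm_cmean => [|x]; first exact: l2dot_continuous.
rewrite rnormM rnorm_conj mulrC; apply: ler_pM; rewrite ?rnorm_ge0//.
exact: cfun_vals_le.
Qed.

Lemma orthonormal_expand n (e : 'I_n -> cfun R G) i :
  (forall i j, l2dot (e i) (e j) = (i == j)%:R) ->
  e i = \sum_j l2dot (e i) (e j) *: e j.
Proof.
move=> eON; rewrite (bigD1 i)//= eON eqxx scale1r big1 ?addr0// => j ji.
by rewrite eON eq_sym (negbTE ji) scale0r.
Qed.

Lemma l2dot_residual n (e : 'I_n -> cfun R G) (g : cfun R G) i :
  (forall i j, l2dot (e i) (e j) = (i == j)%:R) ->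
  l2dot (g - \sum_j l2dot g (e j) *: e j) (e i) = 0.
Proof.
move=> eON; rewrite l2dotBl l2dot_suml (bigD1 i)//= l2dotZl eON eqxx mulr1.
rewrite big1 ?addr0 ?subrr// => j ji.
by rewrite l2dotZl eON (negbTE ji) mulr0.
Qed.

(** Gram-Schmidt, one generator at a time; a generator already in the span adds no vector.
    Membership in the span is expressed as equality with the Fourier expansion, the form used
    throughout. *)
Lemma orthonormal_basis (s : seq (cfun R G)) : is_haar mu ->
  exists n (e : 'I_n -> cfun R G), (forall i j, l2dot (e i) (e j) = (i == j)%:R) /\
    forall f : cfun R G, lspan [set` s] f <-> f = \sum_i l2dot f (e i) *: e i.
Proof.
move=> haar; elim: s => [|g s [n [e [eON eP]]]].
  exists 0%N, (fun=> 0); split => [[]//|f]; rewrite big_ord0; split.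
    by move: f; apply: lspan_min => [|x y -> ->|k x ->|x]//; rewrite ?addr0 ?scaler0.
  by move=> ->; exact: lspan0.
have es i : lspan [set` s] (e i) by apply/eP; exact: orthonormal_expand.
have sgs : lspan [set` s] `<=` lspan [set` g :: s].
  by apply: lspanS => x /= xs; rewrite inE xs orbT.
pose h := g - \sum_i l2dot g (e i) *: e i.
have gs : lspan [set` g :: s] g by apply: lspan_mem; rewrite /= inE eqxx.
have hs : lspan [set` g :: s] h.
  apply: lspanD gs _; rewrite -scaleN1r; apply: lspanZ; apply: lspan_sum => i.
  by apply: lspanZ; exact: sgs.
have he i : l2dot h (e i) = 0 by exact: l2dot_residual.
(* The functions equal to their expansion form a subspace, so it is enough to check g and the old
   span. *)
have closed m (e' : 'I_m -> cfun R G) : g = \sum_i l2dot g (e' i) *: e' i ->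
    (forall f : cfun R G, lspan [set` s] f -> f = \sum_i l2dot f (e' i) *: e' i) ->
    forall f : cfun R G, lspan [set` g :: s] f -> f = \sum_i l2dot f (e' i) *: e' i.
  move=> ge se; apply: lspan_min => [|x y xE yE|k x xE|x].
  - by rewrite big1// => i _; rewrite l2dot0l scale0r.
  - rewrite {1}xE {1}yE -big_split; apply: eq_bigr => i _ /=.
    by rewrite l2dotDl scalerDl.
  - rewrite {1}xE scaler_sumr; apply: eq_bigr => i _.
    by rewrite l2dotZl scalerA.
  - by rewrite /= inE => /predU1P[->//|xs]; apply: se; exact: lspan_mem.
have [h0|hn0] := eqVneq h 0.
  exists n, e; split => // f; split; last by move=> /eP; exact: sgs.
  by apply: closed => [|f' /eP//]; apply/eqP; rewrite -subr_eq0 -/h h0.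
pose r := mean (fun x => rnorm (h x) ^+ 2).
have r0 : 0 < r.
  rewrite lt_def mean_ge0 ?andbT => [|x]; last exact: sqr_ge0.
  apply/eqP => r0; case/eqP: hn0; apply: l2dot_eq0 => //.
  by rewrite l2dot_sqr -/r r0.
pose c := (Num.sqrt r)^-1.
pose e0 := rC c *: h.
have c0 : 0 < c by rewrite invr_gt0 sqrtr_gt0.
have e0e i : l2dot e0 (e i) = 0 by rewrite l2dotZl he mulr0.
have ee0 i : l2dot (e i) e0 = 0 by rewrite -l2dot_conj e0e rmorph0.
have e0e0 : l2dot e0 e0 = 1.
  rewrite l2dotZl l2dotZr rC_conj l2dot_sqr -/r -!rCM -rC1; congr rC.
  by rewrite mulrA -expr2 exprVn sqr_sqrtr ?ltW// mulVf ?gt_eqF.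
(* The new vector gets index 0 and the old ones are shifted by [lift ord0]. *)
pose e' (i : 'I_n.+1) := oapp e e0 (unlift ord0 i).
have e'0 : e' ord0 = e0 by rewrite /e' unlift_none.
have e'S j : e' (lift ord0 j) = e j by rewrite /e' liftK.
exists n.+1, e'; split.
  move=> i j; case: (unliftP ord0 i) => [i'|] ->; case: (unliftP ord0 j) => [j'|] ->.
  - by rewrite !e'S eON (inj_eq (@lift_inj _ _)).
  - by rewrite e'S e'0 ee0.
  - by rewrite e'S e'0 e0e.
  - by rewrite e'0 e0e0.
move=> f; split; last first.
  move=> ->; rewrite big_ord_recl e'0; apply: lspanD.
    by apply: lspanZ; exact: lspanZ.
  by apply: lspan_sum => i; apply: lspanZ; rewrite e'S; exact: sgs.
move: f; apply: closed => [|f fs].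
  rewrite big_ord_recl e'0; under eq_bigr do rewrite e'S.
  apply/eqP; rewrite -subr_eq -/h; apply/eqP.
  (* Since [h = c^-1 *: e0] and [g - h] lies in the old span, which is orthogonal to [e0]. *)
  have hh : l2dot g e0 = (rC c)^-1.
    have gE : g = (rC c)^-1 *: e0 + \sum_i l2dot g (e i) *: e i.
      rewrite /e0 scalerA mulVf ?scale1r ?/h ?subrK//.
      by rewrite -rC0; apply/eqP => /rC_inj cc; rewrite cc ltxx in c0.
    rewrite gE l2dotDl l2dotZl e0e0 mulr1 l2dot_suml big1 ?addr0// => i _.
    by rewrite l2dotZl ee0 mulr0.
  rewrite hh /e0 scalerA mulVf ?scale1r//.
  by rewrite -rC0; apply/eqP => /rC_inj cc; rewrite cc ltxx in c0.
have fE := (eP f).1 fs.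
rewrite big_ord_recl e'0 {1}fE; under [in RHS]eq_bigr do rewrite e'S.
suff -> : l2dot f e0 = 0 by rewrite scale0r add0r.
by rewrite fE l2dot_suml big1// => i _; rewrite l2dotZl ee0 mulr0.
Qed.

End complex_integral.

Local Open Scope sesquilinear_scope.
Local Open Scope quotient_scope.

(** * Unitary representations *)

Section adjoint.
Context {C : numClosedFieldType}.

Lemma adjointM m n p (A : 'M[C]_(m, n)) (B : 'M[C]_(n, p)) :
  (A *m B)^t* = B^t* *m A^t*.
Proof. by rewrite trmx_mul map_mxM. Qed.

Lemma adjointD m n (A B : 'M[C]_(m, n)) : (A + B)^t* = A^t* + B^t*.
Proof. by apply/matrixP => i j; rewrite !mxE rmorphD. Qed.

Lemma adjointZ m n a (A : 'M[C]_(m, n)) : (a *: A)^t* = a^* *: A^t*.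
Proof. by apply/matrixP => i j; rewrite !mxE rmorphM. Qed.

Lemma adjoint0 m n : (0 : 'M[C]_(m, n))^t* = 0.
Proof. by rewrite trmx0 map_mx0. Qed.

Lemma adjoint_sum m n (I : Type) (r : seq I) (P : pred I) (F : I -> 'M[C]_(m, n)) :
  (\sum_(i <- r | P i) F i)^t* = \sum_(i <- r | P i) (F i)^t*.
Proof.
by elim/big_rec2: _ => [|i A B _ <-]; [exact: adjoint0|rewrite adjointD].
Qed.

Lemma adjointE m n (A : 'M[C]_(m, n)) i j : (A^t*) i j = (A j i)^*.
Proof. by rewrite !mxE. Qed.

Lemma adjoint_delta m n i j :
  (delta_mx i j : 'M[C]_(m, n))^t* = delta_mx j i.
Proof. by apply/matrixP => a b; rewrite !mxE rmorph_nat andbC. Qed.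

Lemma mxtrace_adjoint n (A : 'M[C]_n) : \tr (A^t*) = (\tr A)^*.
Proof.
by rewrite /mxtrace rmorph_sum; apply: eq_bigr => i _; rewrite adjointE.
Qed.

Lemma mxtrace_mul_adjoint m n (A B : 'M[C]_(m, n)) :
  \tr (A *m B^t*) = \sum_i \sum_j A i j * (B i j)^*.
Proof.
apply: eq_bigr => i _; rewrite mxE; apply: eq_bigr => j _.
by rewrite adjointE.
Qed.

Lemma mxtrace_adjoint_eq0 m n (A : 'M[C]_(m, n)) : \tr (A *m A^t*) = 0 -> A = 0.
Proof.
rewrite mxtrace_mul_adjoint => /eqP.
rewrite psumr_eq0 => [/allP h|i _]; last first.
  by apply: sumr_ge0 => j _; exact: mul_conjC_ge0.
apply/matrixP => i j; rewrite mxE; apply/eqP.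
have := h i (mem_index_enum _); rewrite psumr_eq0 => [/allP h'|k _]; last first.
  exact: mul_conjC_ge0.
by have := h' j (mem_index_enum _); rewrite /= mul_conjC_eq0.
Qed.

Lemma adjoint_mul_eq0 m n (A : 'M[C]_(m, n)) : A^t* *m A = 0 -> A = 0.
Proof.
move=> h; apply: mxtrace_adjoint_eq0.
by rewrite mxtrace_mulC h mxtrace0.
Qed.

End adjoint.

Section unitary_representations.
Context {R : realType} {G : compactGroupType}.
Local Notation C := (Cplx R).
Implicit Types p q : unitary_rep R G.

Lemma rmx_entry_continuous p i j : continuous (fun x => p x i j : C).
Proof.
have -> : (fun x => p x i j : C) = (fun x => (p x *m delta_mx j (0 : 'I_1)) i 0).
  apply/funext => x; rewrite mxE (bigD1 j)//= big1 ?addr0 => [|k kj].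
    by rewrite mxE !eqxx mulr1.
  by rewrite mxE (negbTE kj) mulr0.
move=> x; apply: (@continuous_comp _ _ _ (fun x => p x *m delta_mx j (0 : 'I_1))
  (fun M : 'cV[C]_(rdim p) => M i 0)); first exact: rmx_continuous.
exact: coord_continuous.
Qed.

Lemma mx_continuous (T : topologicalType) m n (F : T -> 'M[C]_(m, n)) :
  (forall i j, continuous (fun x => F x i j)) -> continuous F.
Proof.
move=> cF x A [P PF PA].
have : \forall y \near x, forall i, forall j, P i j (F y i j).
  apply: filter_forall => i; apply: filter_forall => j.
  exact: (cF i j x _ (PF i j)).
by apply: filterS => y Py; apply: PA.
Qed.

Lemma rmx1 p : p 1%g = 1%:M.
Proof.
have := rmxM p 1%g 1%g; rewrite mulg1 => /(congr1 (mulmx ((p 1%g)^t*))).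
have /unitarymxP/mulmx1C pp := rmx_unitary p 1%g.
by rewrite mulmxA pp mul1mx => <-.
Qed.

Lemma rmxV p x : p x^-1%g = (p x)^t*.
Proof.
have := rmxM p x^-1%g x; rewrite mulVg rmx1 => /(congr1 (mulmx^~ ((p x)^t*))).
have /unitarymxP pp := rmx_unitary p x.
by rewrite mul1mx -mulmxA pp mulmx1.
Qed.

Fact rep_coef_subproof p (A : 'M[C]_(rdim p)) :
  continuous (fun x : G => \tr (A *m (p x)^t*) : C).
Proof.
have -> : (fun x : G => \tr (A *m (p x)^t*) : C) =
    (fun x => \sum_i \sum_j A i j * (p x i j)^*).
  by apply/funext => x; rewrite mxtrace_mul_adjoint.
apply: continuous_csum => i; apply: continuous_csum => j; apply: continuous_cZ.
by apply: continuous_cconj; exact: rmx_entry_continuous.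
Qed.
(* The elements of [coef_space p]: [A i j] is the coefficient of the conjugate of
   the matrix entry [p x i j]. *)
Definition rep_coef p A : cfun R G := mkcfun (@rep_coef_subproof p A).

Lemma rep_coefE p A x : rep_coef A x = \tr (A *m (p x)^t*).
Proof. by []. Qed.

Lemma rep_coefD p (A B : 'M[C]_(rdim p)) : rep_coef (A + B) = rep_coef A + rep_coef B.
Proof.
apply: cfunP => x; rewrite rep_coefE mulmxDl mxtraceD.
by [].
Qed.

Lemma rep_coefZ p a (A : 'M[C]_(rdim p)) : rep_coef (a *: A) = a *: rep_coef A.
Proof. by apply: cfunP => x; rewrite rep_coefE -scalemxAl mxtraceZ. Qed.

Lemma rep_coef0 p : rep_coef (0 : 'M[C]_(rdim p)) = 0.
Proof. by rewrite -(scale0r 0) rep_coefZ scale0r. Qed.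

Lemma rep_coef_sum p (I : Type) (r : seq I) (P : pred I) (F : I -> 'M[C]_(rdim p)) :
  rep_coef (\sum_(i <- r | P i) F i) = \sum_(i <- r | P i) rep_coef (F i).
Proof.
by elim/big_rec2: _ => [|i a u _ <-]; [exact: rep_coef0|rewrite rep_coefD].
Qed.

Lemma matrix_coefE p (v u : 'cV[C]_(rdim p)) :
  matrix_coef v u = rep_coef (v *m u^t*).
Proof.
apply: cfunP => x; rewrite rep_coefE.
transitivity (dotmx v^T (p x *m u)^T) => //.
rewrite dotmxE -mulmxA -adjointM mxtrace_mulC [RHS]/mxtrace big_ord1 !mxE.
by apply: eq_bigr => i _; rewrite !mxE mulrC.
Qed.

Lemma coef_spaceP p f : coef_space p f <-> exists A : 'M[C]_(rdim p), f = rep_coef A.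
Proof.
split.
  move: f; apply: lspan_min => [|f g [A ->] [B ->]|k f [A ->]|f [v [u ->]]].
  - by exists 0; rewrite rep_coef0.
  - by exists (A + B); rewrite rep_coefD.
  - by exists (k *: A); rewrite rep_coefZ.
  by exists (v *m u^t*); exact: matrix_coefE.
move=> [A ->].
have -> : rep_coef A = \sum_i \sum_j A i j *:
    matrix_coef (delta_mx i 0 : 'cV[C]_(rdim p)) (delta_mx j 0).
  rewrite {1}(matrix_sum_delta A) rep_coef_sum; apply: eq_bigr => i _.
  rewrite rep_coef_sum; apply: eq_bigr => j _; rewrite rep_coefZ; congr (_ *: _).
  rewrite matrix_coefE; congr rep_coef; apply/matrixP => a b.
  rewrite !mxE big_ord1 !mxE eqxx !andbT.
  by case: (a == i); case: (b == j); rewrite ?mul0r ?mul1r ?rmorph0 ?rmorph1.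
by apply: lspan_sum => i; apply: lspan_sum => j; apply: lspanZ; apply: lspan_mem;
  exists (delta_mx i 0), (delta_mx j 0).
Qed.

(** The trace identity behind three changes of representation: translating the argument, passing to
    an equivalent representation, and compressing to a subrepresentation. *)
Lemma rep_coef_conjugate p q (U : 'M[C]_(rdim p, rdim q)) (V : 'M[C]_(rdim q, rdim p))
    (A : 'M[C]_(rdim p)) x :
  \tr (A *m (U *m q x *m V)^t*) = rep_coef (U^t* *m A *m V^t*) x.
Proof.
rewrite rep_coefE !adjointM !mulmxA mxtrace_mulC !mulmxA.
by [].
Qed.

Lemma biregular_rep_coef p (A : 'M[C]_(rdim p)) a b :
  biregular a b (rep_coef A) = rep_coef (p a *m A *m (p b)^t*).
Proof.
apply: cfunP => x; transitivity (\tr (A *m (p (a^-1 * x * b)%g)^t*)) => //.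
by rewrite !rmxM rep_coef_conjugate rmxV trmxCK.
Qed.

(** Schur's lemma: an eigenspace of M is invariant and nonzero, hence everything. *)
Lemma schur_scalar p (M : 'M[C]_(rdim p)) : irreducible_rep p ->
  (forall x, M *m p x = p x *m M) ->
  exists c : C, M = c%:M.
Proof.
move=> [d0 irr] comm.
(* Eigenvectors are row vectors here, whereas the representation acts on columns; hence the
   transpose. *)
have [a /eigenvalueP[v vM v0]] := eigenvalue_closed M^T d0.
exists a; pose N := M - a%:M.
have commN x : N *m p x = p x *m N.
  by rewrite mulmxBl mulmxBr comm scalar_mxC.
have Nv : N *m v^T = 0.
  by rewrite mulmxBl -[M]trmxK -trmx_mul vM mul_scalar_mx linearZ subrr.
have [|W0|Wf] := irr (lker (linfun (mulmx N))).
- move=> x u; rewrite !memv_ker !lfunE /= => /eqP Nu.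
  by rewrite mulmxA commN -mulmxA Nu mulmx0.
- have : v^T \in lker (linfun (mulmx N)) by rewrite memv_ker lfunE /= Nv.
  by rewrite W0 memv0 trmx_eq0 (negbTE v0).
- apply/eqP; rewrite -subr_eq0; apply/eqP; apply/matrixP => i j.
  have : (delta_mx j 0 : 'cV[C]_(rdim p)) \in lker (linfun (mulmx N)) by rewrite Wf memvf.
  by rewrite memv_ker lfunE /= -colE => /eqP/colP/(_ i); rewrite !mxE.
Qed.

(** [T^t* *m T] and [T *m T^t*] commute with irreducible representations, so both are scalars; they
    share one value c > 0, and dividing T by the square root of c makes it unitary on both sides. *)
Lemma schur_equiv (p q : irrep R G) (T : 'M[C]_(rdim q, rdim p)) :
  (forall x, T *m p x = q x *m T) -> T != 0 -> rep_equiv p q.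
Proof.
move=> TE T0.
have TE' x : T^t* *m q x = p x *m T^t*.
  have := congr1 (fun M => M^t*) (TE x^-1%g).
  by rewrite /= !adjointM !rmxV !trmxCK => ->.
have [c cE] : exists c : C, T^t* *m T = c%:M.
  apply: (schur_scalar (irrepP p)) => x.
  by rewrite -mulmxA TE mulmxA TE' mulmxA.
have [c' cE'] : exists c : C, T *m T^t* = c%:M.
  apply: (schur_scalar (irrepP q)) => x.
  by rewrite -mulmxA TE' mulmxA TE mulmxA.
have c0 : c != 0.
  apply: contra_neq T0 => c0; apply: adjoint_mul_eq0.
  by rewrite cE c0 raddf0.
have cc : c' = c.
  (* Both sides are [T *m T^t* *m T]. *)
  have : c' *: T = c *: T by rewrite -mul_scalar_mx -cE' -mulmxA cE scalar_mxC mul_scalar_mx.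
  move/eqP; rewrite -subr_eq0 -scalerBl scaler_eq0 (negbTE T0) orbF subr_eq0.
  by move/eqP.
have cge0 : 0 <= c.
  have [d0 _] := irrepP p; pose i0 := Ordinal d0.
  have := congr1 (fun M : 'M[C]_(rdim p) => M i0 i0) cE.
  rewrite /= mxE => E; have := E; rewrite mxE eqxx mulr1n => <-.
  by apply: sumr_ge0 => i _; rewrite adjointE mulrC mul_conjC_ge0.
have s0 : sqrtC c != 0 by rewrite sqrtC_eq0.
have sc : (sqrtC c)^-1 * ((sqrtC c)^-1)^* * c = 1.
  have /CrealP -> : (sqrtC c)^-1 \is Num.real.
    by rewrite realE invr_ge0 sqrtC_ge0 cge0.
  by rewrite -expr2 exprVn sqrtCK mulVf.
apply/asboolP; exists ((sqrtC c)^-1 *: T); split.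
- apply/unitarymxP; rewrite adjointZ -scalemxAl -scalemxAr scalerA cE' cc.
  by rewrite scale_scalar_mx sc.
- apply/unitarymxP; rewrite trmxCK adjointZ -scalemxAl -scalemxAr scalerA cE.
  by rewrite scale_scalar_mx [X in X * _]mulrC sc.
- by move=> x; rewrite -scalemxAl -scalemxAr TE.
Qed.

End unitary_representations.

(** * Schur orthogonality relations *)

Section schur_orthogonality.
Context {R : realType} {G : compactGroupType}.
Variable mu : probability (borelType G) R.
Hypothesis haar : is_haar mu.
Local Notation C := (Cplx R).
Local Notation cmean := (cmean mu).
Local Notation l2dot := (l2dot mu).

Lemma entry_prod_continuous (p q : unitary_rep R G) i j k l :
  continuous (fun x => q x i j * (p x k l)^* : C).
Proof.
apply: continuous_cM; first exact: rmx_entry_continuous.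
by apply: continuous_cconj; exact: rmx_entry_continuous.
Qed.

(** T is the entrywise mean of [q x *m delta_mx j l *m (p x)^t*] over x; the substitution of [y * x]
    for x shows that it intertwines p and q. *)
Lemma averaged_intertwiner (p q : unitary_rep R G) j l y :
  let T := \matrix_(i, k) cmean (fun x => q x i j * (p x k l)^*) in
  T *m p y = q y *m T.
Proof.
move=> T; apply/matrixP => i k; rewrite !mxE.
transitivity (cmean (fun x => q x i j * (p (y^-1 * x)%g k l)^*)).
  rewrite (eq_cmean _ (g := fun x => \sum_b p y b k * (q x i j * (p x b l)^*))).
    rewrite cmean_sum => [|b]; last by apply: continuous_cZ; exact: entry_prod_continuous.
    apply: eq_bigr => b _; rewrite cmean_Z; last exact: entry_prod_continuous.
    by rewrite mxE mulrC.
  move=> x; rewrite rmxM rmxV mxE rmorph_sum mulr_sumr; apply: eq_bigr => b _.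
  by rewrite rmorphM adjointE /= conjCK mulrCA.
transitivity (cmean (fun x => q (y * x)%g i j * (p x k l)^*)).
  have c1 : continuous (fun x => q (y * x)%g i j * (p x k l)^* : C).
    apply: continuous_cM.
      exact: (continuous_compose (@continuous_mulgl _ y)
        (@rmx_entry_continuous _ _ q i j)).
    by apply: continuous_cconj; exact: rmx_entry_continuous.
  rewrite -(cmean_mull haar y^-1%g c1).
  by apply: eq_cmean => x; rewrite mulVKg.
rewrite (eq_cmean _ (g := fun x => \sum_a q y i a * (q x a j * (p x k l)^*))).
  rewrite cmean_sum => [|b]; last by apply: continuous_cZ; exact: entry_prod_continuous.
  apply: eq_bigr => b _; rewrite cmean_Z; last exact: entry_prod_continuous.
  by rewrite mxE.
by move=> x; rewrite rmxM mxE mulr_suml; apply: eq_bigr => a _; rewrite mulrA.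
Qed.

Lemma schur_orth_neq (p q : irrep R G) i j k l : ~~ rep_equiv p q ->
  cmean (fun x => q x i j * (p x k l)^*) = 0.
Proof.
move=> pq.
pose T := \matrix_(i, k) cmean (fun x => q x i j * (p x k l)^*).
have [T0|T0] := eqVneq T 0.
  have := congr1 (fun M : 'M[C]_(rdim q, rdim p) => M i k) T0.
  by rewrite /= mxE mxE.
by case/negP: pq; apply: schur_equiv T0; exact: averaged_intertwiner.
Qed.

Lemma schur_orth_eq (p : irrep R G) i j k l :
  cmean (fun x => p x i j * (p x k l)^*) = (rdim p)%:R^-1 * ((i == k) && (j == l))%:R.
Proof.
pose T := \matrix_(i, k) cmean (fun x => p x i j * (p x k l)^*).
have [c cE] : exists c : C, T = c%:M.
  by apply: (schur_scalar (irrepP p)) => x; exact: averaged_intertwiner.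
have TE a b : cmean (fun x => p x a j * (p x b l)^*) = c *+ (a == b).
  by have := congr1 (fun M : 'M[C]_(rdim p) => M a b) cE; rewrite /= !mxE.
have [d0 _] := irrepP p.
have dn0 : (rdim p)%:R != 0 :> C by rewrite pnatr_eq0 -lt0n.
(* The scalar c is read off from the trace of T: under the mean stands the inner product of two
   columns of the unitary matrix [p x]. *)
have : \sum_a cmean (fun x => p x a j * (p x a l)^*) = (j == l)%:R.
  rewrite -cmean_sum => [|a]; last exact: entry_prod_continuous.
  rewrite -[RHS](cmean_cst mu); apply: eq_cmean => x.
  have /unitarymxP/mulmx1C := rmx_unitary p x.
  move=> /matrixP/(_ l j); rewrite !mxE eq_sym => <-.
  by apply: eq_bigr => a _; rewrite adjointE mulrC.
under eq_bigr do rewrite TE eqxx mulr1n.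
rewrite sumr_const card_ord TE => h.
have -> : c = (rdim p)%:R^-1 * (j == l)%:R by rewrite -h -[c *+ _]mulr_natl mulKf.
by case: (i == k); rewrite ?andbF ?mulr0 ?mulr1n.
Qed.

Lemma l2dot_rep_coefE (p q : unitary_rep R G) (A : 'M[C]_(rdim p)) (B : 'M[C]_(rdim q)) :
  l2dot (rep_coef A) (rep_coef B) = \sum_i \sum_j \sum_k \sum_l
    A i j * (B k l)^* * cmean (fun x => q x k l * (p x i j)^*).
Proof.
have cf i j k l : continuous (fun x => A i j * (B k l)^* * (q x k l * (p x i j)^*) : C).
  by apply: continuous_cZ; exact: entry_prod_continuous.
rewrite /l2dot (eq_cmean _ (g := fun x => \sum_i \sum_j \sum_k \sum_l
    A i j * (B k l)^* * (q x k l * (p x i j)^*))).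
  rewrite cmean_sum => [|i]; last by do 3![apply: continuous_csum => ?]; exact: cf.
  apply: eq_bigr => i _.
  rewrite cmean_sum => [|j]; last by do 2![apply: continuous_csum => ?]; exact: cf.
  apply: eq_bigr => j _.
  rewrite cmean_sum => [|k]; last by apply: continuous_csum => ?; exact: cf.
  apply: eq_bigr => k _.
  rewrite cmean_sum => [|l]; last exact: cf.
  apply: eq_bigr => l _.
  by rewrite cmean_Z//; exact: entry_prod_continuous.
move=> x; rewrite !rep_coefE !mxtrace_mul_adjoint mulr_suml; apply: eq_bigr => i _.
rewrite mulr_suml; apply: eq_bigr => j _.
rewrite rmorph_sum mulr_sumr; apply: eq_bigr => k _.
rewrite rmorph_sum mulr_sumr; apply: eq_bigr => l _ /=.
by rewrite rmorphM /= conjCK mulrACA [X in _ * X]mulrC.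
Qed.

Lemma l2dot_rep_coef_neq (p q : irrep R G) (A : 'M[C]_(rdim p)) (B : 'M[C]_(rdim q)) :
  ~~ rep_equiv p q -> l2dot (rep_coef A) (rep_coef B) = 0.
Proof.
move=> pq; rewrite l2dot_rep_coefE; do 4![rewrite big1// => ? _].
by rewrite schur_orth_neq// mulr0.
Qed.

Lemma l2dot_rep_coef_eq (p : irrep R G) (A B : 'M[C]_(rdim p)) :
  l2dot (rep_coef A) (rep_coef B) = (rdim p)%:R^-1 * \tr (A *m B^t*).
Proof.
rewrite l2dot_rep_coefE mxtrace_mul_adjoint mulr_sumr; apply: eq_bigr => i _.
rewrite mulr_sumr; apply: eq_bigr => j _.
rewrite (bigD1 i)//= [X in _ + X]big1 ?addr0 => [|k ki]; last first.
  by rewrite big1// => l _; rewrite schur_orth_eq (negbTE ki) !mulr0.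
rewrite (bigD1 j)//= big1 ?addr0 => [|l lj]; last first.
  by rewrite schur_orth_eq (negbTE lj) andbF !mulr0.
by rewrite schur_orth_eq !eqxx mulr1 mulrC.
Qed.

End schur_orthogonality.

(** * Decomposition of biregular-invariant spaces *)

Section dual_sums.
Context {R : realType} {G : compactGroupType}.
Local Notation C := (Cplx R).
Local Notation dmx := (fun p : dual R G => 'M[C]_(rdim (repr p))).
Implicit Types (L : {fset dual R G}) (p q : dual R G).

Lemma dual_neq p q : p != q -> ~~ rep_equiv (repr p) (repr q).
Proof.
apply: contra => pq.
have : \pi_(dual R G) (repr p) = \pi_(dual R G) (repr q) by apply/eqmodP.
by rewrite !reprK => ->.
Qed.

Lemma dual_repr (q : irrep R G) : rep_equiv (repr (\pi_(dual R G) q)) q.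
Proof.
have : \pi_(dual R G) (repr (\pi_(dual R G) q)) = \pi_(dual R G) q by rewrite reprK.
by move/eqmodP.
Qed.

(** One coefficient matrix per class turns freeness and orthogonality of the spaces [coef_space]
    into statements about matrices. *)
Definition dual_sum L (f : cfun R G) :=
  exists A : forall p, dmx p, f = \sum_(p <- L) rep_coef (A p).

Lemma dual_sum0 L : dual_sum L 0.
Proof. by exists (fun=> 0); rewrite big1// => p _; rewrite rep_coef0. Qed.

Lemma dual_sumD L f g : dual_sum L f -> dual_sum L g -> dual_sum L (f + g).
Proof.
move=> [A ->] [B ->]; exists (fun p => A p + B p).
by rewrite -big_split; apply: eq_bigr => p _; rewrite rep_coefD.
Qed.

Lemma dual_sumZ L a f : dual_sum L f -> dual_sum L (a *: f).
Proof.
move=> [A ->]; exists (fun p => a *: A p).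
by rewrite scaler_sumr; apply: eq_bigr => p _; rewrite rep_coefZ.
Qed.

Lemma dual_sum_sum L (I : Type) (r : seq I) (P : pred I) (F : I -> cfun R G) :
  (forall i, dual_sum L (F i)) -> dual_sum L (\sum_(i <- r | P i) F i).
Proof.
by move=> LF; apply: (big_ind (dual_sum L)) => //; [exact: dual_sum0|exact: dual_sumD].
Qed.

Lemma dual_sum1 L p (A : dmx p) : p \in L -> dual_sum L (rep_coef A).
Proof.
move=> pL.
(* The matrix size depends on the class, so A is transported along [p = q]; the family is 0 at the
   other classes. *)
exists (fun q => if pselect (p = q) is left pq then eq_rect p dmx A q pq else 0).
rewrite (bigD1_seq p pL (fset_uniq L)) /= big1 ?addr0 => [|q qp].
  case: pselect => // pp; congr rep_coef.
  by rewrite -[LHS]/(eq_rect p dmx A p erefl) (Prop_irrelevance pp erefl).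
by case: pselect => [E|_]; [rewrite E eqxx in qp|rewrite rep_coef0].
Qed.

Lemma dual_sumS L L' f : (L `<=` L')%fset -> dual_sum L f -> dual_sum L' f.
Proof.
move=> /fsubsetP LL' [A ->]; rewrite big_seq_cond.
rewrite (_ : \sum_(_ <- _ | _) _ = \sum_(p <- L) if p \in L then rep_coef (A p) else 0).
  by apply: dual_sum_sum => p; case: ifPn => [/LL'|_]; [exact: dual_sum1|exact: dual_sum0].
rewrite [RHS]big_seq [LHS](eq_bigl (fun p => p \in L)) => [|p]; last by rewrite andbT.
by apply: eq_bigr => p ->.
Qed.

Lemma rep_coef_equiv (p q : irrep R G) (A : 'M[C]_(rdim p)) : rep_equiv p q ->
  exists B : 'M[C]_(rdim q), rep_coef A = rep_coef B.
Proof.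
move=> /asboolP[T [_ /unitarymxP + TE]]; rewrite trmxCK => TT.
exists ((T^t*)^t* *m A *m T^t*); apply: cfunP => x.
rewrite -rep_coef_conjugate rep_coefE; congr (\tr (_ *m _^t*)).
by rewrite -mulmxA -TE mulmxA TT mul1mx.
Qed.

Lemma dual_sum_irrep (q : irrep R G) (A : 'M[C]_(rdim q)) :
  dual_sum [fset (\pi_(dual R G) q)]%fset (rep_coef A).
Proof.
have /(rep_coef_equiv A)[B ->] : rep_equiv q (repr (\pi_(dual R G) q)).
  by rewrite rep_equiv_sym dual_repr.
by apply: dual_sum1; rewrite inE.
Qed.

End dual_sums.

(** * Complete reducibility of unitary representations *)

Section complete_reducibility.
Context {R : realType} {G : compactGroupType}.
Local Notation C := (Cplx R).
Implicit Types p : unitary_rep R G.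

(** [U^t* *m U] is the orthogonal projection onto the row space of U, so the second hypothesis says
    that this space is stable; compression to it is then multiplicative. *)
Lemma subrep p r (U : 'M[C]_(r, rdim p)) : U \is unitarymx ->
  (forall x, U *m p x = U *m p x *m U^t* *m U) ->
  exists q : unitary_rep R G, exists e : rdim q = r,
    forall x, castmx (e, e) (q x) = U *m p x *m U^t*.
Proof.
move=> /unitarymxP UU UE.
pose f x := U *m p x *m U^t*.
have fM x y : f (x * y)%g = f x *m f y.
  by rewrite /f rmxM !mulmxA -UE.
have f1 : f 1%g = 1%:M by rewrite /f rmx1 mulmx1.
have fV x : f x^-1%g = (f x)^t*.
  by rewrite /f rmxV !adjointM trmxCK mulmxA.
have fU x : f x \is unitarymx.
  by apply/unitarymxP; rewrite -fV -fM mulgV.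
have fC (u : 'cV[C]_r) : continuous (fun x => f x *m u).
  apply: mx_continuous => i j.
  have -> : (fun x => (f x *m u) i j) =
      (fun x => \sum_a \sum_b (U i a * (U^t* *m u) b j) * p x a b).
    apply/funext => x; rewrite /f -!mulmxA mxE; apply: eq_bigr => a _.
    rewrite mxE mulr_sumr; apply: eq_bigr => b _.
    by rewrite mulrAC mulrA.
  apply: continuous_csum => a; apply: continuous_csum => b.
  by apply: continuous_cZ; exact: rmx_entry_continuous.
by exists (UnitaryRep fM fU fC), erefl => x; rewrite castmx_id.
Qed.

(** The rows of U and V are orthonormal bases of the adjoints of W and of its orthogonal complement.
    Unitarity makes the complement stable as well. *)
Lemma invariant_isometry p (W : {vspace 'cV[C]_(rdim p)}) :
  (forall x u, u \in W -> p x *m u \in W) -> W <> 0%VS -> W <> fullv ->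
  exists r s (U : 'M[C]_(r, rdim p)) (V : 'M[C]_(s, rdim p)),
    [/\ U \is unitarymx, V \is unitarymx, (r < rdim p)%N, (s < rdim p)%N
      & U^t* *m U + V^t* *m V = 1%:M] /\
    forall x, U *m p x = U *m p x *m U^t* *m U /\ V *m p x = V *m p x *m V^t* *m V.
Proof.
move=> Winv W0 Wf.
(* W consists of columns and the Gram-Schmidt process acts on rows; taking adjoints passes from one
   to the other. *)
pose B : 'M[C]_(\dim W, rdim p) := \matrix_i ((vbasis W)`_i)^t*.
have rowB i : row i B = ((vbasis W)`_i)^t* by rewrite rowK.
have memB u : u \in W -> (u^t* <= B)%MS.
  move=> uW; rewrite (coord_vbasis uW) adjoint_sum.
  apply: summx_sub => i _; rewrite adjointZ; apply: scalemx_sub.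
  by rewrite -rowB row_sub.
have Bmem u : (u^t* <= B)%MS -> u \in W.
  move=> /submxP[D uD].
  have -> : u = \sum_i (D 0 i)^* *: (vbasis W)`_i.
    rewrite -[u]trmxCK uD mulmx_sum_row adjoint_sum; apply: eq_bigr => i _.
    by rewrite adjointZ rowB trmxCK.
  apply: memv_suml => i _; apply: memvZ; apply: vbasis_mem.
  by rewrite mem_nth// size_tuple.
have Bst x : (B *m p x <= B)%MS.
  apply/row_subP => i; rewrite row_mul rowB.
  have -> : ((vbasis W)`_i)^t* *m p x = (p x^-1%g *m (vbasis W)`_i)^t*.
    by rewrite adjointM rmxV trmxCK.
  apply: memB; apply: Winv; apply: vbasis_mem.
  by rewrite mem_nth// size_tuple.
pose M := schmidt_complete B; pose U := usubmx M; pose V := dsubmx M.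
have UE0 : U = schmidt (row_base B) by rewrite /U /M /schmidt_complete col_mxKu.
have UB : (U :=: B)%MS.
  rewrite UE0; apply: eqmx_trans (eq_row_base B).
  by apply: eqmx_schmidt_free; exact: row_base_free.
have Mu : M \is unitarymx := schmidt_complete_unitarymx B.
have rk := add_rank_ortho B.
have ME : M = col_mx U V by rewrite vsubmxK.
have /unitarymxP := Mu; rewrite ME tr_col_mx map_row_mx mul_col_row scalar_mx_block.
move=> /eq_block_mx[UU1 UV0 _ VV1].
have Uu : U \is unitarymx by apply/unitarymxP.
have Vu : V \is unitarymx by apply/unitarymxP.
have UV1 : U^t* *m U + V^t* *m V = 1%:M.
  rewrite -mul_row_col -map_row_mx -tr_col_mx -ME.
  (* M is square only up to the equality [rk]; generalising it lets the sizes be rewritten before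
     left and right inverses are exchanged. *)
  move: Mu; move: (M); rewrite rk => M' /unitarymxP; exact: mulmx1C.
have rk1 : (0 < \rank B)%N.
  rewrite lt0n mxrank_eq0; apply/eqP => B0; apply: W0.
  apply/eqP; rewrite -subv0; apply/subvP => u /memB/submxP[D].
  by rewrite B0 mulmx0 => uD; rewrite memv0 -[u]trmxCK uD adjoint0.
have rk2 : (\rank B < rdim p)%N.
  rewrite ltn_neqAle rank_leq_col andbT; apply/eqP => Bf; apply: Wf.
  apply/eqP; rewrite eqEsubv subvf /=; apply/subvP => u _; apply: Bmem.
  by apply: submx_full; rewrite /row_full Bf.
have UE x : U *m p x = U *m p x *m U^t* *m U.
  have /submxP[D DE] : (U *m p x <= U)%MS.
    by rewrite UB (eqmxMr _ UB).
  by rewrite DE -!mulmxA (mulmxA U) UU1 mul1mx.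
exists (\rank B), _, U, V; split.
  split => //; apply: leq_trans (eq_leq rk).
  by rewrite -add1n leq_add2r.
move=> x; split; first exact: UE.
(* The stability of the row space of U under [x^-1], after taking adjoints. *)
have VU : V *m p x *m U^t* = 0.
  have : U *m p x^-1%g *m V^t* = 0 by rewrite UE -(mulmxA _ U) UV0 mulmx0.
  move/(congr1 (fun N : 'M[C]_(_, _) => N^t*)).
  by rewrite !adjointM rmxV !trmxCK adjoint0 mulmxA.
by rewrite -{1}[V *m p x]mulmx1 -UV1 mulmxDr !mulmxA VU mul0mx add0r.
Qed.

(** Strong induction on the dimension: along an invariant subspace and its complement [p x] is block
    diagonal, and a coefficient of p is the sum of coefficients of the two blocks. *)
Lemma coef_dual_sum p :
  exists L : {fset dual R G}, forall A : 'M[C]_(rdim p), dual_sum L (rep_coef A).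
Proof.
have [n] := ubnP (rdim p); elim: n => // n IH in p *.
rewrite ltnS => pn.
(* Irreducibility includes positive dimension, so dimension 0 is handled apart; its coefficients
   vanish. *)
have [p0|p0] := posnP (rdim p).
  exists fset0%fset => A; rewrite (_ : rep_coef A = 0); first exact: dual_sum0.
  apply: cfunP => x; rewrite rep_coefE /mxtrace big1// => i _.
  by have := ltn_ord i; rewrite {2}p0.
have [irr|nirr] := pselect (irreducible_rep p).
  exists [fset (\pi_(dual R G) (Irrep irr))]%fset => A.
  exact: (@dual_sum_irrep _ _ (Irrep irr) A).
have [W [Winv W0 Wf]] : exists W : {vspace 'cV[C]_(rdim p)},
    [/\ forall x u, u \in W -> p x *m u \in W, W <> 0%VS & W <> fullv].
  apply: contrapT => /forallNP noW; apply: nirr; split => // W Winv.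
  apply: contrapT => /not_orP[W0 Wf]; apply: (noW W).
  by split.
have [r [s [U [V [[Uu Vu rp sp UV] UVE]]]]] := invariant_isometry Winv W0 Wf.
have [q1 [e1 q1E]] := subrep Uu (fun x => (UVE x).1).
have [q2 [e2 q2E]] := subrep Vu (fun x => (UVE x).2).
subst r; subst s.
have [L1 L1P] := IH q1 (leq_trans rp pn).
have [L2 L2P] := IH q2 (leq_trans sp pn).
exists (L1 `|` L2)%fset => A.
have -> : rep_coef A = rep_coef ((U^t*)^t* *m A *m U^t*) + rep_coef ((V^t*)^t* *m A *m V^t*).
  apply: cfunP => x; rewrite -[RHS]/(rep_coef _ x + rep_coef _ x) -!rep_coef_conjugate.
  rewrite rep_coefE -mxtraceD -mulmxDr; congr (\tr (_ *m _)).
  rewrite -adjointD; congr (_^t*).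
  have := q1E x; have := q2E x; rewrite !castmx_id => -> ->.
  rewrite -[LHS]mul1mx -UV mulmxDl -!mulmxA !(mulmxA U) !(mulmxA V).
  by rewrite {1}(UVE x).1 {1}(UVE x).2 -!mulmxA.
apply: dual_sumD.
  by apply: dual_sumS (L1P _); exact: fsubsetUl.
by apply: dual_sumS (L2P _); exact: fsubsetUr.
Qed.

End complete_reducibility.

Lemma cfun_sumE (R : realType) (K : compactHausdorffType) (I : Type) (r : seq I)
    (P : pred I) (F : I -> cfun R K) (x : K) :
  (\sum_(i <- r | P i) F i : cfun R K) x = \sum_(i <- r | P i) F i x.
Proof. by elim/big_rec2: _ => [//|i a u _ <-]. Qed.

Section biregular_theory.
Context {R : realType} {G : compactGroupType}.
Implicit Types (f g : cfun R G) (a b : G).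

Lemma biregularE a b f x : biregular a b f x = f (a^-1 * x * b)%g.
Proof. by []. Qed.

Lemma biregularD a b f g : biregular a b (f + g) = biregular a b f + biregular a b g.
Proof. exact: cfunP. Qed.

Lemma biregularZ a b c f : biregular a b (c *: f) = c *: biregular a b f.
Proof. exact: cfunP. Qed.

Lemma biregular0 a b : biregular a b (0 : cfun R G) = 0.
Proof. exact: cfunP. Qed.

Lemma biregular_sum a b (I : Type) (r : seq I) (P : pred I) (F : I -> cfun R G) :
  biregular a b (\sum_(i <- r | P i) F i) = \sum_(i <- r | P i) biregular a b (F i).
Proof.
by elim/big_rec2: _ => [|i u v _ <-]; [exact: biregular0|rewrite biregularD].
Qed.

End biregular_theory.

Section decomposition.
Context {R : realType} {G : compactGroupType}.
Variable mu : probability (borelType G) R.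
Hypothesis haar : is_haar mu.
Local Notation C := (Cplx R).
Local Notation l2dot := (l2dot mu).
Local Notation dmx := (fun p : dual R G => 'M[C]_(rdim (repr p))).
Implicit Types (L : {fset dual R G}) (p q : dual R G).

Lemma l2dot_left a (u v : cfun R G) :
  l2dot (biregular a 1%g u) (biregular a 1%g v) = l2dot u v.
Proof.
rewrite /l2dot -(cmean_mull haar a^-1%g (@l2dot_continuous _ _ u v)).
by apply: eq_cmean => x; rewrite !biregularE mulg1.
Qed.

(** The two functions f and g cover both one-sided translations: the left one makes the regular
    representation continuous, the right one occurs in [convolution_mem]. *)
Lemma continuous_biregular_coef (f g : G -> G) (u v : cfun R G) :
  continuous f -> continuous g ->
  continuous (fun a => l2dot (biregular (f a) (g a) u) v).
Proof.
move=> cf cg; apply: (@continuous_cmean_param R G mu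
  (fun yx => u ((f yx.1)^-1 * yx.2 * g yx.1)%g * (v yx.2)^*)).
apply: continuous_cM.
  apply: (@continuous_compose _ _ _
    (fun yx : G * G => (f yx.1)^-1 * yx.2 * g yx.1)%g u); last exact: cfun_continuous.
  apply: continuous_mulg_fun; last exact: continuous_fst_fun.
  apply: continuous_mulg_fun; last exact: continuous_snd_prod.
  by apply: continuous_invg_fun; exact: continuous_fst_fun.
apply: continuous_cconj.
apply: (@continuous_compose _ _ _ (fun yx : G * G => yx.2) v).
  exact: continuous_snd_prod.
exact: cfun_continuous.
Qed.

Section left_representation.
Variables (n : nat) (e : 'I_n -> cfun R G).
Hypothesis eON : forall i j, l2dot (e i) (e j) = (i == j)%:R.
Hypothesis einv : forall a j, biregular a 1%g (e j) =
  \sum_i l2dot (biregular a 1%g (e j)) (e i) *: e i.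

Let rho (a : G) : 'M[C]_n := \matrix_(i, j) l2dot (biregular a 1%g (e j)) (e i).

Let rhoM x y : rho (x * y)%g = rho x *m rho y.
Proof.
apply/matrixP => i j; rewrite !mxE.
have -> : biregular (x * y)%g 1%g (e j) = biregular x 1%g (biregular y 1%g (e j)).
  by apply: cfunP => z; rewrite !biregularE invgM !mulg1 mulgA.
rewrite einv biregular_sum l2dot_suml; apply: eq_bigr => k _.
by rewrite biregularZ l2dotZl !mxE mulrC.
Qed.

Let rho_unitary x : rho x \is unitarymx.
Proof.
apply/unitarymxP; apply: mulmx1C; apply/matrixP => j k.
rewrite !mxE.
transitivity (l2dot (biregular x 1%g (e k)) (biregular x 1%g (e j))).
  rewrite [in RHS](einv x j) l2dot_sumr; apply: eq_bigr => i _.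
  by rewrite l2dotZr adjointE !mxE.
by rewrite l2dot_left eON eq_sym.
Qed.

Let rho_continuous (u : 'cV[C]_n) : continuous (fun x => rho x *m u).
Proof.
apply: mx_continuous => i j.
have -> : (fun x => (rho x *m u) i j) =
    (fun x => \sum_k u k j * l2dot (biregular x 1%g (e k)) (e i)).
  by apply/funext => x; rewrite mxE; apply: eq_bigr => k _; rewrite mxE mulrC.
apply: continuous_csum => k; apply: continuous_cZ.
by apply: continuous_biregular_coef => y; [exact: cvg_id|exact: cvg_cst].
Qed.

Lemma orthonormal_coef_space : exists pi : unitary_rep R G,
  forall j, exists A : 'M[C]_(rdim pi), e j = rep_coef A.
Proof.
exists (UnitaryRep rhoM rho_unitary rho_continuous) => j.
(* Evaluating the left translate of [e j] by [x^-1] at the unit gives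
   [e j x = \sum_b e b 1 * (rho x j b)^*]; so row j holds the values at the unit and the other rows
   are 0. *)
exists (\matrix_(a, b) ((a == j)%:R * e b 1%g)); apply: cfunP => x.
rewrite rep_coefE mxtrace_mul_adjoint /= (bigD1 j)//=.
rewrite [X in _ + X]big1 ?addr0 => [|k kj]; last first.
  by rewrite big1// => l _; rewrite mxE (negbTE kj) !mul0r.
have : biregular x^-1%g 1%g (e j) 1%g =
    (\sum_i l2dot (biregular x^-1%g 1%g (e j)) (e i) *: e i : cfun R G) 1%g by rewrite -einv.
rewrite biregularE invgK !mulg1 => ->; rewrite cfun_sumE; apply: eq_bigr => i _.
rewrite !mxE eqxx mul1r [RHS]mulrC; congr (_ * _).
rewrite l2dot_conj -(l2dot_left x) ; congr l2dot.
by apply: cfunP => z; rewrite !biregularE invgK !mulg1 mulVKg.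
Qed.

End left_representation.

Lemma l2dot_dual_neq p q (A : dmx p) (B : dmx q) :
  p != q -> l2dot (rep_coef A) (rep_coef B) = 0.
Proof. by move=> /dual_neq; exact: l2dot_rep_coef_neq. Qed.

Lemma l2dot_dual_sum1 L (A : forall q, dmx q) p (B : dmx p) : p \in L ->
  l2dot (\sum_(q <- L) rep_coef (A q)) (rep_coef B) =
    (rdim (repr p))%:R^-1 * \tr (A p *m B^t*).
Proof.
move=> pL; rewrite l2dot_suml (bigD1_seq p pL (fset_uniq L)) /= big1 => [|q qp].
  by rewrite addr0 l2dot_rep_coef_eq.
exact: l2dot_dual_neq.
Qed.

Lemma l2dot_dual_sum L (A B : forall q, dmx q) :
  l2dot (\sum_(q <- L) rep_coef (A q)) (\sum_(q <- L) rep_coef (B q)) =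
  \sum_(q <- L) (rdim (repr q))%:R^-1 * \tr (A q *m (B q)^t*).
Proof.
rewrite l2dot_sumr big_seq [RHS]big_seq; apply: eq_bigr => q qL.
exact: l2dot_dual_sum1.
Qed.

Lemma rdim_neq0 p : (rdim (repr p))%:R != 0 :> C.
Proof. by have [d0 _] := irrepP (repr p); rewrite pnatr_eq0 -lt0n. Qed.

Lemma dual_sum_free L (A : forall q, dmx q) : \sum_(q <- L) rep_coef (A q) = 0 ->
  forall p, p \in L -> A p = 0.
Proof.
move=> A0 p pL; have := l2dot_dual_sum1 A (A p) pL; rewrite A0 l2dot0l => /esym/eqP.
rewrite mulf_eq0 invr_eq0 (negbTE (rdim_neq0 p)) /= => /eqP.
exact: mxtrace_adjoint_eq0.
Qed.

(* [l2dot (biregular a b f) s] is a combination of coefficients of the [p in L],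
   first as a function of a, then as a function of b; these are free. *)
Lemma translates_orthogonal L (A D : forall q, dmx q) :
  (forall a b, l2dot (biregular a b (\sum_(q <- L) rep_coef (A q)))
    (\sum_(q <- L) rep_coef (D q)) = 0) ->
  forall p, p \in L -> A p != 0 -> D p = 0.
Proof.
move=> AD p pL Ap.
(* For fixed b, the conjugate of the pairing is a dual sum in a, whose matrix at q is a nonzero
   multiple of the one claimed to vanish. *)
have DA b : D p *m repr p b *m (A p)^t* = 0.
  have := @dual_sum_free L
    (fun q => (rdim (repr q))%:R^-1 *: (D q *m repr q b *m (A q)^t*)) _ p pL.
  move=> h; have {h} : (rdim (repr p))%:R^-1 *: (D p *m repr p b *m (A p)^t*) = 0.
    apply: h; apply: cfunP => a; rewrite cfun_sumE.
    transitivity (0 : C) => //.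
    have := AD a b; rewrite biregular_sum.
    under eq_bigr do rewrite biregular_rep_coef.
    rewrite (l2dot_dual_sum L (fun q => repr q a *m A q *m (repr q b)^t*) D).
    move=> /(congr1 (fun z : C => z^*)); rewrite rmorph0 rmorph_sum => E.
    apply: etrans E; apply: eq_bigr => q _; rewrite rep_coefE rmorphM fmorphV rmorph_nat /=.
    rewrite -scalemxAl mxtraceZ; congr (_ * _).
    by rewrite -mxtrace_adjoint !adjointM !trmxCK !mulmxA.
  by move/eqP; rewrite scaler_eq0 invr_eq0 (negbTE (rdim_neq0 p)) /= => /eqP.
(* The conjugate trace of [DA b] against a matrix unit is a coefficient function of b for the single
   class p, hence its matrix is 0. *)
have DEA i k : (D p)^t* *m delta_mx i k *m A p = 0.
  have := @dual_sum_free [fset p]%fset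
    (fun q => if pselect (p = q) is left pq then
       eq_rect p dmx ((D p)^t* *m delta_mx i k *m A p) q pq else 0) _ p.
  rewrite inE => /(_ _ (eqxx p)).
  case: pselect => // pp; rewrite (Prop_irrelevance pp erefl) /=; apply.
  rewrite big_seq_fset1; case: pselect => // pp'; rewrite (Prop_irrelevance pp' erefl) /=.
  apply: cfunP => b; rewrite rep_coefE.
  have := congr1 (fun M : dmx p => (\tr (delta_mx k i *m M))^*) (DA b).
  rewrite /= mulmx0 mxtrace0 rmorph0 => E; apply: etrans E.
  rewrite -mxtrace_adjoint !adjointM !trmxCK !mulmxA adjoint_delta.
  by rewrite mxtrace_mulC !mulmxA mxtrace_mulC !mulmxA.
apply/matrixP => i a; rewrite mxE.
(* Entry [(a, b)] of the product in [DEA i k] is [(D p i a)^* * A p k b], so one nonzero entry of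
   [A p] kills all of [D p]. *)
have [k [b Akb]] : exists k b, A p k b != 0.
  apply: contrapT => /forallNP h; case/eqP: Ap; apply/matrixP => k b.
  by rewrite mxE; apply/eqP; apply: contrapT => /negP Akb; apply: (h k); exists b.
have := congr1 (fun M : dmx p => M a b) (DEA i k).
rewrite /= mxE (bigD1 k)//= big1 ?addr0 => [|l lk]; last first.
  rewrite mxE big1 ?mul0r// => c _.
  by rewrite !mxE (negbTE lk) andbF mulr0.
rewrite mxE (bigD1 i)//= big1 ?addr0 => [|c ci]; last first.
  by rewrite !mxE (negbTE ci) mulr0.
rewrite adjointE mxE !eqxx mulr1 mxE => /eqP.
by rewrite mulf_eq0 (negbTE Akb) orbF conjC_eq0 => /eqP.
Qed.

(** The residual s of g modulo S is orthogonal to S, in particular to every translate of the given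
    element, so it has no component at p. As g lives at p alone, s is orthogonal to g too, hence to
    itself. *)
Lemma isotypic_subset (n : nat) (e : 'I_n -> cfun R G) (S : set (cfun R G)) L
    (A : forall q, dmx q) p :
  (forall i j, l2dot (e i) (e j) = (i == j)%:R) ->
  (forall f, S f <-> f = \sum_i l2dot f (e i) *: e i) ->
  biregular_invariant S -> (forall f, S f -> dual_sum L f) ->
  S (\sum_(q <- L) rep_coef (A q)) -> p \in L -> A p != 0 ->
  forall B : dmx p, S (rep_coef B).
Proof.
move=> eON SE Sinv SL SA pL Ap B.
pose g := rep_coef B; pose s := g - \sum_i l2dot g (e i) *: e i.
have eS i : S (e i) by apply/SE; exact: orthonormal_expand.
have es i : l2dot (e i) s = 0 by rewrite -l2dot_conj l2dot_residual// rmorph0.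
have Ss f : S f -> l2dot f s = 0.
  by move=> /SE ->; rewrite l2dot_suml big1// => i _; rewrite l2dotZl es mulr0.
have [D sD] : dual_sum L s.
  apply: dual_sumD; first exact: dual_sum1.
  rewrite -scaleN1r; apply: dual_sumZ; apply: dual_sum_sum => i.
  by apply: dual_sumZ; apply: SL.
have Dp : D p = 0.
  apply: (@translates_orthogonal L A D _ p pL Ap) => a b.
  by rewrite -sD; apply: Ss; exact: Sinv.
have gs : l2dot g s = 0.
  by rewrite sD -l2dot_conj l2dot_dual_sum1// Dp mul0mx mxtrace0 mulr0 rmorph0.
have s0 : s = 0.
  apply: (l2dot_eq0 haar); rewrite {1}/s l2dotBl gs l2dot_suml big1 ?subrr// => i _.
  by rewrite l2dotZl es mulr0.
by apply/SE/eqP; rewrite -subr_eq0; apply/eqP.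
Qed.

Theorem biregular_decomposition (S : set (cfun R G)) :
  S 0 -> (forall f g, S f -> S g -> S (f + g)) -> (forall a f, S f -> S (a *: f)) ->
  finite_dimensional S -> biregular_invariant S ->
  exists2 L : {fset dual R G}, is_direct_sum L (fun p => coef_space (repr p)) S &
    forall f, S f <-> dual_sum L f.
Proof.
move=> S0 SD SZ [s SE] Sinv.
have [n [e [eON eP]]] := orthonormal_basis s haar.
have {}SE f : S f <-> f = \sum_i l2dot f (e i) *: e i by rewrite SE; exact: eP.
have eS i : S (e i) by apply/SE; exact: orthonormal_expand.
have einv a j : biregular a 1%g (e j) = \sum_i l2dot (biregular a 1%g (e j)) (e i) *: e i.
  by apply/SE; exact: Sinv.
have [pi piE] := orthonormal_coef_space eON einv.
have [L' L'P] := coef_dual_sum pi.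
have SL' f : S f -> dual_sum L' f.
  move=> /SE ->; apply: dual_sum_sum => i; apply: dual_sumZ.
  by have [A ->] := piE i.
(* Only classes whose whole coefficient space lies in S are kept; by [isotypic_subset] elements of S
   have no component at the others. *)
pose L := [fset p in L' | `[< forall B : dmx p, S (rep_coef B) >]]%fset.
have LS p (B : dmx p) : p \in L -> S (rep_coef B).
  by rewrite !inE /= => /andP[_ /asboolP].
have SsumL (F : dual R G -> cfun R G) : (forall p, p \in L -> S (F p)) ->
    S (\sum_(p <- L) F p).
  move=> FS; rewrite big_seq; apply: (big_ind S) => //.
have SL f : S f <-> dual_sum L f.
  split=> [Sf|[A ->]]; last by apply: SsumL => p pL; exact: LS.
  have [A fA] := SL' f Sf; exists A; rewrite fA.
  have LL' : (L `<=` L')%fset by apply/fsubsetP => p; rewrite !inE => /andP[].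
  apply/esym; apply: (big_fset_incl _ LL') => p pL' pL.
  have [->|Ap] := eqVneq (A p) 0; first by rewrite rep_coef0.
  case/negP: pL; rewrite !inE /= pL' /=; apply/asboolP.
  by apply: (isotypic_subset eON SE Sinv SL' _ pL' Ap); rewrite -fA.
exists L => //; split.
  apply/seteqP; split => f.
    move=> /SL[A ->]; exists (fun p => rep_coef (A p)) => //= p _.
    by apply/coef_spaceP; exists (A p).
  move=> [F FE <-]; apply: SsumL => p pL.
  by have /coef_spaceP[A ->] := FE p pL; exact: LS.
move=> F FE F0.
have exA : forall p, exists A : dmx p, p \in L -> F p = rep_coef A.
  move=> p; have [pL|pL] := boolP (p \in L); last by exists 0.
  by have /coef_spaceP[A ->] := FE p pL; exists A.
pose A p : dmx p := projT1 (cid (exA p)).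
have FA p : p \in L -> F p = rep_coef (A p) := projT2 (cid (exA p)).
move=> p pL; rewrite FA// (_ : A p = 0) ?rep_coef0//.
apply: (@dual_sum_free L A) pL; rewrite -[RHS]F0 big_seq [RHS]big_seq.
by apply: eq_bigr => q qL; rewrite FA.
Qed.

End decomposition.

(** * Projection constants *)

Section cfun_norm.
Context {R : realType} {K : compactHausdorffType}.
Implicit Types f g : cfun R K.

Lemma rnorm_cfun_ge f x : rnorm (f x) <= rnorm f.
Proof. exact: cfun_vals_le. Qed.

Lemma rnorm_cfun_le f (c : R) : 0 <= c -> (forall x, rnorm (f x) <= c) -> rnorm f <= c.
Proof. exact: sup_cfun_vals_le. Qed.

Lemma cauchy_real_limit (T : Type) (F : set_system T) (phi : T -> R) :
  ProperFilter F ->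
  (forall e : R, 0 < e -> exists2 A, F A & forall u v, A u -> A v -> `|phi u - phi v| < e) ->
  exists l : R, forall e : R, 0 < e -> F [set u | `|phi u - l| < e].
Proof.
move=> FF h.
have /cvg_ex[/= l /cvgrPdist_lt lP] : cvg (phi @ F).
  apply: R_complete; apply: cauchy_exP => e e0.
  have [A FA hA] := h e e0; have [g Ag] := filter_ex FA.
  exists (phi g); apply: (@filterS _ F _ A) FA => t At.
  by rewrite /= -ball_normE /ball_ /=; exact: hA.
exists l => e e0; apply: filterS (lP e e0) => g /=.
by rewrite distrC.
Qed.

Lemma cfun_ball f g (e : R) : ball f (rC e) g <-> rnorm (f - g) < e.
Proof. by rewrite -ball_normE /ball_ /= norm_rnorm rC_lt. Qed.

(** Completeness makes C(G) an admissible superspace in [projconst]; the lower bound is obtained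
    there. *)
Lemma cfun_complete (F : set_system (cfun R K)) :
  ProperFilter F -> cauchy F -> cvg F.
Proof.
move=> FF /cauchyP F_cauchy; apply/cvg_ex.
have Fc (e : R) : 0 < e -> exists2 A, F A &
    forall g h, A g -> A h -> forall x, rnorm (g x - h x) < e.
  move=> e0; have [|f0 Ff0] := F_cauchy (rC (e / 2)).
    by rewrite -rC0 rC_lt divr_gt0.
  exists (ball f0 (rC (e / 2))) => // g h /cfun_ball g0 /cfun_ball h0 x.
  have -> : g x - h x = (f0 x - h x) - (f0 x - g x).
    by rewrite opprB [RHS]addrC addrA subrK.
  apply: le_lt_trans (ler_rnormD _ _) _; rewrite rnormN (splitr e); apply: ltrD.
    exact: le_lt_trans (rnorm_cfun_ge (f0 - h) x) h0.
  exact: le_lt_trans (rnorm_cfun_ge (f0 - g) x) g0.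
have /choice[re reP] : forall x : K, exists l : R, forall e : R, 0 < e ->
    F [set g : cfun R K | `|cre (g x) - l| < e].
  move=> x; apply: (@cauchy_real_limit _ F (fun g : cfun R K => cre (g x))) => e e0.
  have [A FA hA] := Fc e e0; exists A => // g h Ag Ah.
  by rewrite -creN -creD; apply: le_lt_trans (cre_le_rnorm _) (hA _ _ Ag Ah x).
have /choice[im imP] : forall x : K, exists l : R, forall e : R, 0 < e ->
    F [set g : cfun R K | `|cim (g x) - l| < e].
  move=> x; apply: (@cauchy_real_limit _ F (fun g : cfun R K => cim (g x))) => e e0.
  have [A FA hA] := Fc e e0; exists A => // g h Ag Ah.
  by rewrite -cimN -cimD; apply: le_lt_trans (cim_le_rnorm _) (hA _ _ Ag Ah x).
pose l (x : K) : Cplx R := (re x +i* im x)%C.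
have unif (e : R) : 0 < e -> F [set g : cfun R K | forall x, rnorm (g x - l x) < e].
  move=> e0; have e3 : 0 < e / 3 by rewrite divr_gt0.
  have [A FA hA] := Fc _ e3; apply: filterS (FA) => g Ag x.
  (* h depends on x, but the distance from g to h is controlled uniformly, so the resulting bound on
     [g x - l x] does not depend on h. *)
  have [h [Ah [/= hre him]]] : exists h, (A `&` ([set g | `|cre (g x) - re x| < e / 3] `&`
      [set g | `|cim (g x) - im x| < e / 3])) h.
    apply: (@filter_ex _ F); apply: filterI => //.
    by apply: filterI; [exact: (reP x _ e3)|exact: (imP x _ e3)].
  have -> : g x - l x = (g x - h x) + (h x - l x) by rewrite addrA subrK.
  apply: le_lt_trans (ler_rnormD _ _) _.
  have h1 := hA _ _ Ag Ah x.
  have h2 : rnorm (h x - l x) <= `|cre (h x) - re x| + `|cim (h x) - im x|.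
    by have := rnorm_le_reim (h x - l x); rewrite creD cimD creN cimN.
  by lra.
have lcont : continuous l.
  move=> x; apply: continuous_cplx => e e0; have e3 : 0 < e / 3 by rewrite divr_gt0.
  have [g gP] := filter_ex (unif _ e3).
  have := continuous_cplx_near (@cfun_continuous R K g x) e3.
  apply: filterS => y gxy.
  have -> : l x - l y = - (g x - l x) + (g x - g y) + (g y - l y).
    by ring.
  apply: le_lt_trans (ler_rnormD _ _) _.
  have h1 := ler_rnormD (- (g x - l x)) (g x - g y).
  have h2 := gP x; have h3 := gP y; rewrite rnormN in h1.
  by lra.
exists (mkcfun lcont); apply/cvg_ballP => _ /gt0_rC[e e0 ->].
have e2 : 0 < e / 2 by rewrite divr_gt0.
apply: filterS (unif _ e2) => g gP; apply/cfun_ball.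
apply: (@le_lt_trans _ _ (e / 2)); last by lra.
apply: rnorm_cfun_le => [|x]; first exact: ltW.
by rewrite rnormB; exact: ltW.
Qed.

HB.instance Definition _ := Uniform_isComplete.Build (cfun R K) cfun_complete.

End cfun_norm.

Section kernel.
Context {R : realType} {G : compactGroupType}.
Variable mu : probability (borelType G) R.
Hypothesis haar : is_haar mu.
Local Notation C := (Cplx R).
Local Notation l2dot := (l2dot mu).

Definition dual_kernel (L : {fset dual R G}) : cfun R G :=
  \sum_(p <- L) rep_coef ((rdim (repr p))%:R%:M : 'M[C]_(rdim (repr p))).

Lemma dual_kernel_conj L x : dual_kernel L x =
  (\sum_(p <- L) (rdim (repr p))%:R * character (repr p) x)^*.
Proof.
rewrite /dual_kernel cfun_sumE rmorph_sum; apply: eq_bigr => p _.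
by rewrite rep_coefE mul_scalar_mx mxtraceZ mxtrace_adjoint rmorphM rmorph_nat.
Qed.

(** Both sides are the reproducing kernel of the space: [kx], the conjugate of [z |-> k(z^-1 x)],
    belongs to it and represents evaluation at x, and the right side comes from expanding [kx]. The
    factor [rdim] cancels the inverse dimension in Schur orthogonality. *)
Lemma dual_kernelE (L : {fset dual R G}) (n : nat) (e : 'I_n -> cfun R G) :
  (forall i j, l2dot (e i) (e j) = (i == j)%:R) ->
  (forall f, dual_sum L f <-> f = \sum_i l2dot f (e i) *: e i) ->
  forall x y, dual_kernel L (y^-1 * x)%g = \sum_i e i x * (e i y)^*.
Proof.
move=> eON LE x y.
pose kx : cfun R G := \sum_(p <- L) rep_coef ((rdim (repr p))%:R *: repr p x).
have kxS : dual_sum L kx 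
  by exists (fun p : dual R G => (rdim (repr p))%:R *: repr p x : 'M[C]_(rdim (repr p))).
have kxE z : dual_kernel L (z^-1 * x)%g = (kx z)^*.
  rewrite /dual_kernel /kx !cfun_sumE rmorph_sum; apply: eq_bigr => p _.
  rewrite !rep_coefE mul_scalar_mx -scalemxAl !mxtraceZ rmorphM rmorph_nat.
  congr (_ * _); rewrite /= -mxtrace_adjoint rmxM rmxV !adjointM !trmxCK.
  exact: mxtrace_mulC.
have repro f : dual_sum L f -> l2dot f kx = f x.
  move=> [A ->]; rewrite (l2dot_dual_sum haar) cfun_sumE; apply: eq_bigr => p _.
  rewrite rep_coefE adjointZ -scalemxAr mxtraceZ conjC_nat mulrA mulVf ?mul1r//.
  exact: rdim_neq0.
have eS i : dual_sum L (e i) by apply/LE; exact: orthonormal_expand.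
rewrite kxE ((LE kx).1 kxS) cfun_sumE rmorph_sum; apply: eq_bigr => i _.
rewrite -[in RHS](repro _ (eS i)).
by rewrite -[in LHS]l2dot_conj rmorphM /= conjCK.
Qed.

End kernel.

Section extension_bound.
Context {R : realType}.
Local Notation C := (Cplx R).

Lemma rnorm_lipschitz_continuous (V W : normedModType C) (f : {linear V -> W}) (M : R) :
  (forall v, rnorm (f v) <= M * rnorm v) -> continuous f.
Proof.
move=> fM v; apply/(@cvgrPdist_lt _ _ _ _ (nbhs_filter v)) => _ /gt0_rC[e e0 ->].
pose d : R := e / (`|M| + 1).
have d0 : 0 < d by rewrite divr_gt0// ltr_wpDl.
have : nbhs v (ball v (rC d)) by apply: nbhsx_ballx; rewrite -rC0 rC_lt.
apply: filterS => w; rewrite -ball_normE /ball_ /= -linearB.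
rewrite !norm_rnorm !rC_lt => vw.
apply: le_lt_trans (fM _) _.
apply: (@le_lt_trans _ _ ((`|M| + 1) * rnorm (v - w))).
  by rewrite ler_wpM2r ?rnorm_ge0// (le_trans (ler_norm _))// lerDl.
by rewrite mulrC -ltr_pdivlMr// ltr_wpDl.
Qed.

(** A linear left inverse t of the isometry j yields the projection [j \o t] onto the range of j,
    with the same norm bound. *)
Lemma rel_projconst_le (X Y : normedModType C) (j : {linear X -> Y}) (t : Y -> X) (M : R) :
  (forall x, `|j x| = `|x|) ->
  (forall a y z, t (a *: y + z) = a *: t y + t z) ->
  (forall x, t (j x) = x) ->
  (0 <= M) -> (forall y, rnorm (t y) <= M * rnorm y) ->
  (rel_projconst (range j) <= M%:E)%E.
Proof.
move=> jiso tlin tj M0 tM.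
pose P0 (y : Y) : Y := j (t y).
have P0lin : linear P0.
  by move=> a y z; rewrite /P0 tlin linearP.
pose P : {linear Y -> Y} := HB.pack P0 (GRing.isLinear.Build C Y Y *:%R P0 P0lin).
have PM y : (rnorm (P y) <= M * rnorm y).
  by have := tM y; rewrite /P /= /P0 /rnorm jiso.
apply: (@le_trans _ _ (opnorm P)).
  apply: ereal_inf_lbound; exists P => //; split.
  - exact: rnorm_lipschitz_continuous PM.
  - by apply/funext => y; rewrite /P /= /P0 tj.
  - apply/seteqP; split => y [z _ <-] /=; first by exists (t z).
    by exists (j z) => //; rewrite /P /= /P0 tj.
apply: ge_ereal_sup => _ [y /= y1 <-]; rewrite lee_fin.
apply: le_trans (PM y) _; rewrite -[leRHS]mulr1.
exact: ler_wpM2l.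
Qed.

End extension_bound.

(** * Upper and lower bounds from a reproducing kernel *)

Section invariant_kernel.
Context {R : realType} {G : compactGroupType}.
Variable mu : probability (borelType G) R.
Hypothesis haar : is_haar mu.
Local Notation C := (Cplx R).
Local Notation l2dot := (l2dot mu).
Local Notation cmean := (cmean mu).
Local Notation mean := (mean mu).

Variables (S : submodClosed (cfun R G)) (n : nat) (e : 'I_n -> cfun R G).
Variable k : cfun R G.
Hypothesis eON : forall i j, l2dot (e i) (e j) = (i == j)%:R.
Hypothesis SE : forall f, f \in S <-> f = \sum_i l2dot f (e i) *: e i.
Hypothesis Sright : forall b f, f \in S -> biregular 1%g b f \in S.
Hypothesis kE : forall x y, k (y^-1 * x)%g = \sum_i e i x * (e i y)^*.

Local Notation normk := (mean (fun x => rnorm (k x))).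

Lemma span_basis_mem i : e i \in S.
Proof. by apply/SE; exact: orthonormal_expand. Qed.

Lemma basis_expand (f : cfun R G) x : f \in S -> f x = \sum_i l2dot f (e i) * e i x.
Proof. by move=> /SE fE; rewrite {1}fE cfun_sumE. Qed.

Lemma kernelV y : k y^-1%g = (k y)^*.
Proof.
have := kE 1%g y; rewrite mulg1 => ->.
have := kE y 1%g; rewrite invg1 mul1g => ->.
by rewrite rmorph_sum; apply: eq_bigr => i _; rewrite rmorphM /= conjCK mulrC.
Qed.

(** The map [y |-> y^-1 * x] is not a left translation, but by [kernelV] the integrand equals
    [|k(x^-1 * y)|], to which left invariance applies. *)
Lemma mean_kernel x : mean (fun y => rnorm (k (y^-1 * x)%g)) = normk.
Proof.
have ck : continuous (fun y => rnorm (k y) : R).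
  by apply: continuous_rnorm_fun; exact: cfun_continuous.
rewrite -(mean_mull haar x^-1%g ck); apply: eq_mean => y.
by rewrite -(rnorm_conj (k (x^-1 * y)%g)) -kernelV invgM invgK.
Qed.

Lemma kernel_reproduces i x : cmean (fun y => e i y * k (y^-1 * x)%g) = e i x.
Proof.
rewrite (eq_cmean _ (g := fun y => \sum_l e l x * (e i y * (e l y)^*))) => [|y]; last first.
  by rewrite kE mulr_sumr; apply: eq_bigr => l _; rewrite mulrCA.
rewrite cmean_sum => [|l]; last by apply: continuous_cZ; exact: l2dot_continuous.
rewrite (bigD1 i)//= big1 => [|l li]; rewrite cmean_Z; try exact: l2dot_continuous.
  by rewrite addr0 -/(l2dot _ _) eON eqxx mulr1.
by rewrite -/(l2dot _ _) eON eq_sym (negbTE li) mulr0.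
Qed.

Section upper_bound.
Variables (Y : normedModType C) (j : {linear subsp S -> Y}).
Hypothesis jiso : forall s, `|j s| = `|s|.

Lemma extend_evaluation (x : G) : exists psi : Y -> C,
  [/\ forall a y z, psi (a *: y + z) = a * psi y + psi z,
      forall y, rnorm (psi y) <= rnorm y
    & forall s : subsp S, psi (j s) = (subsp_val s : cfun R G) x].
Proof.
have [||psi [p1 p2 p3]] := @hahn_banach_cplx R Y _ j
  (fun s => (subsp_val s : cfun R G) x) 1 jiso ler01.
- by [].
- by move=> s; rewrite mul1r; exact: (rnorm_cfun_ge (subsp_val s) x).
by exists psi; split => // y; have := p2 y; rewrite mul1r.
Qed.

Lemma extend_coordinate i : exists (B : R) (c : Y -> C),
  [/\ 0 <= B, forall a y z, c (a *: y + z) = a * c y + c z,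
      forall y, rnorm (c y) <= B * rnorm y
    & forall s : subsp S, c (j s) = l2dot (subsp_val s) (e i)].
Proof.
have [B B0 BP] := l2dot_bound mu (e i).
have [||c [c1 c2 c3]] := @hahn_banach_cplx R Y _ j
  (fun s => l2dot (subsp_val s) (e i)) B jiso B0.
- by move=> a x y; rewrite -l2dotZl -l2dotDl.
- by move=> s; apply: BP => x; exact: (rnorm_cfun_ge (subsp_val s) x).
by exists B, c.
Qed.

Lemma rel_projconst_le_kernel : (rel_projconst (range j) <= normk%:E)%E.
Proof.
have [psi psiP] := choice extend_evaluation.
have [B /choice[c cP]] := choice extend_coordinate.
pose SB := \sum_i B i.
have SB0 : 0 <= SB by apply: sumr_ge0 => i _; have [] := cP i.
apply/lee_addgt0Pr => eps eps0.
(* The quadrature error costs d in the norm of the main sum and [d * SB] in the correction. *)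
pose d := eps / (1 + SB).
have d0 : 0 < d by rewrite divr_gt0// ltr_pwDl.
pose F (o : option 'I_n) (yx : G * G) : C :=
  if o is Some i then e i yx.1 * k (yx.1^-1 * yx.2)%g
  else rC (rnorm (k (yx.1^-1 * yx.2)%g)).
have cF o : continuous (F o).
  case: o => [i|].
    apply: continuous_cM; last exact: continuous_ldiv_fun (@cfun_continuous _ _ _).
    exact: continuous_fst_fun (@cfun_continuous _ _ _).
  apply: continuous_rC_fun; apply: continuous_rnorm_fun.
  exact: continuous_ldiv_fun (@cfun_continuous _ _ _).
have [N [y [w [w0 hF]]]] := cmean_quadrature mu cF d0.
have hk x : \sum_j w j * rnorm (k ((y j)^-1 * x)%g) <= normk + d.
  have := hF None x; rewrite /F /= cmean_rC mean_kernel.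
  have -> : \sum_j0 rC (w j0) * rC (rnorm (k ((y j0)^-1 * x)%g)) - rC normk =
      rC (\sum_j0 w j0 * rnorm (k ((y j0)^-1 * x)%g) - normk).
    rewrite rCD rCN rC_sum; congr (_ - _).
    by apply: eq_bigr => l _; rewrite rCM.
  by rewrite rnorm_rC -lerBlDl; apply: le_trans; exact: ler_norm.
have he i x : rnorm (e i x - \sum_j rC (w j) * (e i (y j) * k ((y j)^-1 * x)%g)) <= d.
  by have := hF (Some i) x; rewrite /F /= kernel_reproduces rnormB.
pose ky (z : G) : cfun R G := biregular z 1%g k.
have kyE z x : ky z x = k (z^-1 * x)%g by rewrite /ky biregularE mulg1.
have kyS z : ky z \in S.
  have -> : ky z = \sum_i (e i z)^* *: e i.
    apply: cfunP => x; rewrite kyE kE cfun_sumE; apply: eq_bigr => i _.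
    by rewrite mulrC.
  by apply: rpred_sum => i _; apply: rpredZ; exact: span_basis_mem.
(* What the discretised integral misses of [e i]; it is small and lies in S. *)
pose E i : cfun R G := e i - \sum_j (rC (w j) * e i (y j)) *: ky (y j).
have ES i : E i \in S.
  rewrite /E -scaleN1r; apply: rpredD; first exact: span_basis_mem.
  by apply: rpredZ; apply: rpred_sum => l _; apply: rpredZ.
have Ed i x : rnorm (E i x) <= d.
  have -> : E i x = e i x - \sum_j rC (w j) * (e i (y j) * k ((y j)^-1 * x)%g); last exact: he.
  rewrite -[LHS]/(e i x - (\sum_j (rC (w j) * e i (y j)) *: ky (y j) : cfun R G) x).
  rewrite cfun_sumE; congr (_ - _); apply: eq_bigr => l _.
  by rewrite -[LHS]/(_ * ky _ x) kyE mulrA.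
(* On [j s] the functional [c i] is the i-th coordinate of s, so the second sum restores exactly
   what the first one misses. *)
pose T (v : Y) : cfun R G :=
  \sum_l (rC (w l) * psi (y l) v) *: ky (y l) + \sum_i c i v *: E i.
have TS v : T v \in S.
  by apply: rpredD; apply: rpred_sum => l _; apply: rpredZ.
pose t v : subsp S := Subsp (TS v).
apply: le_trans (_ : (normk + eps)%:E <= _)%E; last by rewrite EFinD.
have normk0 : 0 <= normk by apply: mean_ge0 => x; exact: rnorm_ge0.
apply: (@rel_projconst_le _ _ _ j t) => //.
- move=> a u v; apply: val_inj.
  rewrite -[LHS]/(T (a *: u + v)) -[RHS]/(a *: T u + T v) /T.
  rewrite scalerDr !scaler_sumr addrACA -!big_split; congr (_ + _).
    apply: eq_bigr => l _ /=; rewrite scalerA -scalerDl; congr (_ *: _).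
    by have [-> _ _] := psiP (y l); rewrite mulrDr mulrCA.
  apply: eq_bigr => i _ /=; rewrite scalerA -scalerDl; congr (_ *: _).
  by have [_ -> _ _] := cP i.
- move=> s; apply: val_inj; rewrite -[LHS]/(T (j s)).
  have sS : subsp_val s \in S by case: s.
  have cE i : c i (j s) = l2dot (subsp_val s) (e i) by have [_ _ _ ->] := cP i.
  rewrite /T [X in _ + X](_ : _ = subsp_val s -
      \sum_l (rC (w l) * psi (y l) (j s)) *: ky (y l)).
    by rewrite addrC subrK.
  have /SE sE := sS.
  transitivity (\sum_i (l2dot (subsp_val s) (e i) *: e i -
      \sum_l (l2dot (subsp_val s) (e i) * (rC (w l) * e i (y l))) *: ky (y l))).
    apply: eq_bigr => i _; rewrite cE /E scalerBr scaler_sumr.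
    by congr (_ - _); apply: eq_bigr => l _; rewrite scalerA.
  rewrite sumrB -sE exchange_big /=; congr (_ - _); apply: eq_bigr => l _.
  rewrite -scaler_suml; congr (_ *: _).
  have [_ _ ->] := psiP (y l); rewrite (basis_expand _ sS) mulr_sumr.
  by apply: eq_bigr => i _; rewrite mulrCA.
- by rewrite addr_ge0// ltW.
move=> v; apply: rnorm_cfun_le => [|x].
  by rewrite mulr_ge0 ?rnorm_ge0// addr_ge0// ltW.
have TE : T v x = \sum_l rC (w l) * psi (y l) v * k ((y l)^-1 * x)%g +
    \sum_i c i v * E i x.
  rewrite -[LHS]/((\sum_l (rC (w l) * psi (y l) v) *: ky (y l) : cfun R G) x +
    (\sum_i c i v *: E i : cfun R G) x) !cfun_sumE; congr (_ + _).
  by apply: eq_bigr => l _; rewrite -kyE.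
rewrite -[leLHS]/(rnorm (T v x)) TE; apply: le_trans (ler_rnormD _ _) _.
have SBn0 : 1 + SB != 0 by rewrite gt_eqF// ltr_pwDl.
have -> : eps = d + d * SB by rewrite /d; field.
rewrite addrA mulrDl; apply: lerD.
  apply: le_trans (rnorm_sum _ _ _) _.
  apply: le_trans (_ : \sum_l w l * rnorm (k ((y l)^-1 * x)%g) * rnorm v <= _).
    apply: ler_sum => l _; rewrite !rnormM rnorm_rC.
    rewrite ger0_norm// mulrAC ler_wpM2l ?mulr_ge0 ?rnorm_ge0//.
    by have [_ -> _] := psiP (y l).
  by rewrite -mulr_suml ler_wpM2r ?rnorm_ge0.
apply: le_trans (rnorm_sum _ _ _) _; rewrite mulr_sumr mulr_suml; apply: ler_sum => i _.
rewrite rnormM; have [Bi0 _ cB _] := cP i.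
rewrite [leRHS](_ : _ = B i * rnorm v * d); last by ring.
by apply: ler_pM; rewrite ?rnorm_ge0.
Qed.

End upper_bound.

Lemma continuous_swap (T : topologicalType) (F : G * G -> T) :
  continuous F -> continuous (fun xy : G * G => F (xy.2, xy.1)).
Proof.
move=> cF; apply: (@continuous_compose _ _ _ (fun xy : G * G => (xy.2, xy.1)) F) => // x.
by apply: cvg_pair; [exact: continuous_snd_prod|exact: continuous_fst_prod].
Qed.

Section convolution.
Variable h : cfun R G.

Lemma convolution_continuous i :
  continuous (fun yx : G * G => e i yx.1 * h (yx.1^-1 * yx.2)%g).
Proof.
apply: continuous_cM.
  exact: (@continuous_fst_fun _ _ (e i) (@cfun_continuous _ _ (e i))).
exact: (@continuous_ldiv_fun _ _ h (@cfun_continuous _ _ h)).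
Qed.

Fact convolution_subproof i : continuous (fun x => cmean (fun y => e i y * h (y^-1 * x)%g)).
Proof.
apply: (@continuous_cmean_param R G mu (fun xy => e i xy.2 * h (xy.2^-1 * xy.1)%g)).
exact: (@continuous_swap _ _ (@convolution_continuous i)).
Qed.
Definition convolution i : cfun R G := mkcfun (@convolution_subproof i).

Lemma inv_continuous : continuous (fun y => h y^-1%g).
Proof.
apply: (@continuous_compose _ _ _ (fun y : G => y^-1%g) h); last exact: cfun_continuous.
exact: invg_continuous.
Qed.

(** Replacing y by [x * y] exhibits the convolution as a mean of right translates of [e i] weighted
    by [h y^-1]. The coordinates in the basis are integrated one by one. *)
Lemma convolution_mem i : convolution i \in S.
Proof.
have -> : convolution i =
    \sum_l cmean (fun y => l2dot (biregular 1%g y (e i)) (e l) * h y^-1%g) *: e l.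
  apply: cfunP => x; rewrite cfun_sumE.
  rewrite -[LHS]/(cmean (fun y => e i y * h (y^-1 * x)%g)).
  rewrite -(cmean_mull haar x (@continuous_slice1 _ _ _ x (@convolution_continuous i))) /=.
  have ch l : continuous (fun y => l2dot (biregular 1%g y (e i)) (e l) * h y^-1%g).
    apply: continuous_cM; last exact: inv_continuous.
    by apply: continuous_biregular_coef => y; [exact: cvg_cst|exact: cvg_id].
  rewrite (eq_cmean _ (g := fun y => \sum_l e l x *
      (l2dot (biregular 1%g y (e i)) (e l) * h y^-1%g))) => [|y]; last first.
    have -> : e i (x * y)%g = biregular 1%g y (e i) x by rewrite biregularE invg1 mul1g.
    rewrite (@basis_expand (biregular 1%g y (e i)) x); last first.
      by apply: Sright; exact: span_basis_mem.
    rewrite invgM mulgVK mulr_suml; apply: eq_bigr => l _.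
    by rewrite mulrAC mulrC.
  rewrite cmean_sum => [|l]; last by apply: continuous_cZ.
  by apply: eq_bigr => l _; rewrite cmean_Z// mulrC.
by apply: rpred_sum => l _; apply: rpredZ; exact: span_basis_mem.
Qed.

(* The left-hand side is the trace on S of the convolution by h. *)
Lemma convolution_trace : \sum_i l2dot (convolution i) (e i) = cmean (fun y => k y * h y^-1%g).
Proof.
rewrite -cmean_sum; last by move=> i; exact: l2dot_continuous.
(* The integrand in x turns out constant: by [kE] it is the mean over y of [k(x^-1 y) * h(y^-1 x)],
   from which a left translation removes x. *)
rewrite -[RHS](cmean_cst mu); apply: eq_cmean => x.
have ckh : continuous (fun y => k (x^-1 * y)%g * h (y^-1 * x)%g).
  apply: continuous_cM.
    exact: (continuous_compose (@continuous_mulgl _ _) (@cfun_continuous _ _ k)).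
  exact: (@continuous_slice1 _ _ _ x (continuous_ldiv_fun (@cfun_continuous _ _ h))).
transitivity (cmean (fun y => k (x^-1 * y)%g * h (y^-1 * x)%g)); last first.
  rewrite -(cmean_mull haar x ckh); apply: eq_cmean => y.
  by rewrite mulKg invgM mulgVK.
rewrite (eq_cmean _ (g := fun y => \sum_i (e i x)^* * 
  (e i y * h (y^-1 * x)%g))) => [|y]; last first.
  by rewrite kE mulr_suml; apply: eq_bigr => i _; rewrite mulrAC mulrC.
rewrite cmean_sum => [|i]; last first.
  by apply: continuous_cZ; exact: (@continuous_slice1 _ _ _ x (@convolution_continuous i)).
apply: eq_bigr => i _; rewrite cmean_Z; first exact: mulrC.
exact: (@continuous_slice1 _ _ _ x (@convolution_continuous i)).
Qed.

End convolution.

Lemma kernel_pairing_le_opnorm (P : {linear cfun R G -> cfun R G}) (M : R) (h : cfun R G) :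
  0 <= M -> (forall f, rnorm (P f) <= M * rnorm f) ->
  (forall f, f \in S -> P f = f) -> (forall f, P f \in S) ->
  (forall x, rnorm (h x) <= 1) ->
  rnorm (cmean (fun y => k y * h y^-1%g)) <= M.
Proof.
move=> M0 PM PS Pmem h1.
have /choice[B BP] : forall i, exists b : R, 0 <= b /\
    forall (u : cfun R G) N, (forall x, rnorm (u x) <= N) -> rnorm (l2dot u (e i)) <= b * N.
  by move=> i; have [b b0 bP] := l2dot_bound mu (e i); exists b.
pose SB := \sum_i B i.
have SB0 : 0 <= SB by apply: sumr_ge0 => i _; have [] := BP i.
apply/ler_addgt0Pr => eps eps0.
pose D := M + M * SB.
have D0 : 0 <= D by rewrite addr_ge0// mulr_ge0.
(* The excess of the total weight costs [d * M] and the quadrature remainders cost [SB * (M * d)],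
   together [d * D]. *)
pose d := eps / (1 + D).
have Dn0 : 1 + D != 0 by rewrite gt_eqF// ltr_pwDl.
have d0 : 0 < d by rewrite divr_gt0// ltr_pwDl.
(* The constant 1 joins the family in order to bound the total weight. *)
pose F (o : option 'I_n) (yx : G * G) : C :=
  if o is Some i then e i yx.1 * h (yx.1^-1 * yx.2)%g else 1.
have cF o : continuous (F o).
  case: o => [i|]; first exact: convolution_continuous.
  by move=> x; exact: cvg_cst.
have [N [y [w [w0 hF]]]] := cmean_quadrature mu cF d0.
have hw : \sum_j w j <= 1 + d.
  have := hF None 1%g; rewrite /F /= cmean_cst.
  have -> : \sum_j0 rC (w j0) * 1 - 1 = rC (\sum_j0 w j0 - 1).
    rewrite rCD rCN rC_sum; congr (_ - _).
    by apply: eq_bigr => l _; rewrite mulr1.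
  by rewrite rnorm_rC -lerBlDl; apply: le_trans; exact: ler_norm.
pose hy (z : G) : cfun R G := biregular z 1%g h.
have hyE z x : hy z x = h (z^-1 * x)%g by rewrite /hy biregularE mulg1.
have hy1 z : rnorm (hy z) <= 1.
  by apply: rnorm_cfun_le => // x; rewrite hyE.
pose u i := convolution h i.
pose r i : cfun R G := \sum_j (rC (w j) * e i (y j)) *: hy (y j) - u i.
have rd i : rnorm (r i) <= d.
  apply: rnorm_cfun_le => [|x]; first exact: ltW.
  have -> : r i x = \sum_j rC (w j) * (e i (y j) * h ((y j)^-1 * x)%g) - u i x.
    rewrite -[LHS]/((\sum_j (rC (w j) * e i (y j)) *: hy (y j) : cfun R G) x - u i x).
    rewrite cfun_sumE; congr (_ - _); apply: eq_bigr => l _.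
    by rewrite -hyE mulrA.
  exact: (hF (Some i) x).
(* The discretised mean of [(P h(y^-1 .))(y)], the quantity that both bounds are about. *)
pose A := \sum_j rC (w j) * (P (hy (y j)) : cfun R G) (y j).
have AM : rnorm A <= (1 + d) * M.
  apply: le_trans (rnorm_sum _ _ _) _.
  apply: le_trans (_ : \sum_j w j * M <= _); last by rewrite -mulr_suml ler_wpM2r.
  apply: ler_sum => l _; rewrite rnormM rnorm_rC ger0_norm// ler_wpM2l//.
  apply: le_trans (rnorm_cfun_ge _ _) _; apply: le_trans (PM _) _.
  by rewrite -[leRHS]mulr1 ler_wpM2l.
(* Expanding each [P (hy _)] in the basis gathers the nodes inside P, whose argument becomes
   [u i + r i]; P fixes [u i]. *)
have AE : A = \sum_i l2dot (u i) (e i) + \sum_i l2dot (P (r i)) (e i).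
  rewrite -big_split /=.
  transitivity (\sum_i l2dot (P (\sum_j (rC (w j) * e i (y j)) *: hy (y j))) (e i)).
    rewrite /A; under eq_bigr do rewrite (basis_expand _ (Pmem _)) mulr_sumr.
    rewrite exchange_big /=; apply: eq_bigr => i _.
    rewrite linear_sum l2dot_suml; apply: eq_bigr => l _.
    by rewrite linearZ l2dotZl mulrCA mulrC.
  apply: eq_bigr => i _; rewrite -l2dotDl.
  rewrite -[X in l2dot (X + _) _](PS (u i)); last exact: convolution_mem.
  by rewrite -linearD /r addrC subrK.
have rM : rnorm (\sum_i l2dot (P (r i)) (e i)) <= SB * (M * d).
  apply: le_trans (rnorm_sum _ _ _) _; rewrite mulr_suml; apply: ler_sum => i _.
  have [_] := BP i; apply => x; apply: le_trans (rnorm_cfun_ge _ _) _.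
  by apply: le_trans (PM _) _; rewrite ler_wpM2l.
have uE := convolution_trace h.
have : rnorm (\sum_i l2dot (u i) (e i)) <= (1 + d) * M + SB * (M * d).
  have -> : \sum_i l2dot (u i) (e i) = A - \sum_i l2dot (P (r i)) (e i) by rewrite AE addrK.
  apply: le_trans (ler_rnormD _ _) _; rewrite rnormN.
  exact: lerD.
rewrite uE => /le_trans; apply.
have -> : (1 + d) * M + SB * (M * d) = M + d * D by rewrite /D; ring.
rewrite lerD2l /d mulrAC ler_pdivrMr ?ltr_pwDl//.
by rewrite ler_wpM2l ?lerDr// ltW.
Qed.

(** The added eps keeps the approximate sign of k continuous at the zeros of k. As [k y^-1] is the
    conjugate of [k y], the integrand becomes [t^2 / (t + eps)] with [t = |k y|], and
    [(t - eps) * (t + eps) <= t^2]. *)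
Lemma kernel_sign_pairing (eps : R) : 0 < eps ->
  exists2 h : cfun R G, (forall x, rnorm (h x) <= 1) &
    normk - eps <= rnorm (cmean (fun y => k y * h y^-1%g)).
Proof.
move=> eps0.
pose a y := (rnorm (k y) + eps)^-1.
have pos y : 0 < rnorm (k y) + eps by rewrite ltr_wpDl ?rnorm_ge0.
have ck : continuous (fun y => rnorm (k y) : R).
  by apply: continuous_rnorm_fun; exact: cfun_continuous.
have ca : continuous a.
  move=> y; apply: cvgV; first by rewrite gt_eqF.
  by apply: cvgD; [exact: ck|exact: cvg_cst].
have ch : continuous (fun y => rC (a y) * k y).
  by apply: continuous_cM; [exact: continuous_rC_fun|exact: cfun_continuous].
exists (mkcfun ch) => [x|].
  rewrite -[X in rnorm X]/(rC (a x) * k x) rnormM rnorm_rC.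
  rewrite ger0_norm ?invr_ge0 ?(ltW (pos x))//.
  by rewrite ler_pdivrMl// mulr1 lerDl ltW.
have E y : k y * (mkcfun ch : cfun R G) y^-1%g = rC (rnorm (k y) ^+ 2 / (rnorm (k y) + eps)).
  rewrite -[X in _ * X]/(rC (a y^-1%g) * k y^-1%g) kernelV mulrCA normCKr -rCM mulrC.
  by rewrite /a kernelV rnorm_conj.
rewrite (eq_cmean _ E) cmean_rC rnorm_rC.
apply: le_trans (ler_norm _).
have c2 : continuous (fun y => rnorm (k y) ^+ 2 / (rnorm (k y) + eps)).
  move=> y; apply: (@cvgM R _ _ _ _ _ _ _ _ (ca y)).
  exact: (@cvgM R _ _ _ _ _ _ _ (ck y) (ck y)).
rewrite lerBlDr -[X in _ + X](mean_cst mu eps).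
have ceps : continuous (fun _ : G => eps) by move=> x; exact: cvg_cst.
rewrite -mean_D; [|exact: continuous_bintegrable|exact: continuous_bintegrable].
apply: mean_le; [exact: continuous_bintegrable| |move=> y].
  by apply: bintegrableD; exact: continuous_bintegrable.
rewrite -(ler_pM2r (pos y)) mulrDl divfK ?gt_eqF//.
have := rnorm_ge0 (k y); set t := rnorm (k y) => t0.
have : 0 <= eps * eps by rewrite mulr_ge0// ltW.
rewrite expr2; nra.
Qed.

Lemma kernel_le_opnorm (P : {linear cfun R G -> cfun R G}) :
  P \o P = P :> (cfun R G -> cfun R G) -> range P = [set f | f \in S] ->
  (normk%:E <= opnorm P)%E.
Proof.
move=> PP Prange.
have Pmem f : P f \in S.
  have : [set f | f \in S] (P f) by rewrite -Prange; exists f.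
  by [].
have PS f : f \in S -> P f = f.
  move=> fS; have : range P f by rewrite Prange.
  by move=> [g _ <-]; exact: (congr1 (fun Q => Q g) PP).
have op0 : (0 <= opnorm P)%E.
  apply: ereal_sup_ubound; exists 0; first by rewrite /= rnorm0.
  by rewrite linear0 rnorm0.
have [->|opfin] := eqVneq (opnorm P) +oo%E; first by rewrite leey.
have opf : opnorm P \is a fin_num by rewrite ge0_fin_numE// lt_neqAle opfin leey.
rewrite -(fineK opf) lee_fin; set M := fine (opnorm P).
have M0 : 0 <= M by rewrite fine_ge0.
(* The supremum over the unit ball is used at f divided by its norm. *)
have PM f : rnorm (P f) <= M * rnorm f.
  have [->|f0] := eqVneq f 0; first by rewrite linear0 !rnorm0 mulr0.
  have nf0 : 0 < rnorm f.
    by rewrite lt_def rnorm_ge0 andbT; apply: contra_neq f0; exact: rnorm_eq0.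
  have : rnorm (P (rC (rnorm f)^-1 *: f)) <= M.
    rewrite -lee_fin fineK//; apply: ereal_sup_ubound.
    exists (rC (rnorm f)^-1 *: f) => //=.
    by rewrite rnormZ rnorm_rC ger0_norm ?invr_ge0 ?(ltW nf0)// mulVf ?gt_eqF.
  rewrite linearZ rnormZ rnorm_rC ger0_norm ?invr_ge0 ?(ltW nf0)//.
  by rewrite ler_pdivrMl// mulrC.
apply/ler_addgt0Pr => eps eps0.
have [h h1 hk] := kernel_sign_pairing eps0.
rewrite -lerBlDr; apply: le_trans hk _.
exact: (kernel_pairing_le_opnorm M0 PM PS Pmem h1).
Qed.

Theorem projconst_kernel : projconst (subsp S) = normk%:E.
Proof.
apply/eqP; rewrite eq_le; apply/andP; split.
  apply: ge_ereal_sup => _ [Y [j [jiso ->]]].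
  exact: (rel_projconst_le_kernel jiso).
pose v (s : subsp S) : cfun R G := subsp_val s.
have vlin : linear v by [].
pose j : {linear subsp S -> cfun R G} :=
  HB.pack v (GRing.isLinear.Build C (subsp S) (cfun R G) *:%R v vlin).
have jrange : range j = [set f | f \in S].
  apply/seteqP; split => f; first by move=> [[g gS] _ <-].
  by move=> /= fS; exists (Subsp fS).
(* The inclusion of S into C(G) is one of the embeddings over which the supremum is taken. *)
apply: (@le_trans _ _ (rel_projconst (range j))).
  apply: le_ereal_inf_tmp => _ [P [_ PP Pj] <-].
  by apply: kernel_le_opnorm => //; rewrite Pj.
by apply: ereal_sup_ubound; exists (cfun R G : completeNormedModType C), j.
Qed.

End invariant_kernel.

Theorem corollary1p25 (R : realType) (G : compactGroupType)
    (mu : probability (borelType G) R) (S : submodClosed (cfun R G)) :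
  is_haar mu ->
  finite_dimensional [set f | f \in S] ->
  biregular_invariant [set f | f \in S] ->
  exists L : {fset dual R G},
    is_direct_sum L (fun p => coef_space (repr p)) [set f | f \in S] /\
    projconst (subsp S) =
      (\int[mu]_(g in setT)
         (rnorm (\sum_(p <- L)
                   (rdim (repr p))%:R * character (repr p) g))%:E)%E.
Proof.
move=> haar Sfin Sinv.
have [||a f /= fS|L Ldec LS] :=
  @biregular_decomposition R G mu haar [set f | f \in S] _ _ _ Sfin Sinv.
- exact: rpred0.
- by move=> f g /= fS gS; exact: rpredD.
- exact: rpredZ.
exists L; split => //.
have [s Ss] := Sfin.
have [n [e [eON eP]]] := orthonormal_basis s haar.
have SE f : f \in S <-> f = \sum_i l2dot mu f (e i) *: e i.
  by rewrite -eP -Ss.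
have kE : forall x y, dual_kernel L (y^-1 * x)%g = \sum_i e i x * (e i y)^*.
  apply: (dual_kernelE haar eON) => f.
  by rewrite -LS; exact: SE.
have Sright b f : f \in S -> biregular 1%g b f \in S by move=> fS; exact: (Sinv 1%g b f fS).
rewrite (projconst_kernel haar eON SE Sright kE).
have ck : continuous (fun y => rnorm (dual_kernel L y) : R).
  by apply: continuous_rnorm_fun; exact: cfun_continuous.
(* [mean] is real-valued and the statement integrates in the extended reals; integrability
   identifies the two. *)
rewrite /mean /Rintegral fineK; last first.
  exact: integrable_fin_num (continuous_bintegrable mu ck).
by apply: eq_integral => g _; rewrite dual_kernel_conj rnorm_conj.
Qed.
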